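(* There exists a sequence $(G_d)_{d\ge 4}$ of positive real numbers, with $G_d$ depending only on $d$, such that for all integers $n \geq d \geq 4$, \[ \Delta_u(d,n) \leq (n-d)^{\log_2 G_d}, \] and such that, as $d\to\infty$, \[ G_d = (4\ln 2+o(1))\,\frac{d}{(\ln d)^2}. \]
   Context: A polyhedron is a finite intersection of closed half-spaces; it is pointed if it has at least one vertex. The graph of a pointed polyhedron has its vertices as nodes, two of them being adjacent if they are the endpoints of a (bounded) edge of the polyhedron. The diameter of a pointed polyhedron is the diameter of this graph: the largest, over all pairs of vertices, of the minimum number of edges needed to travel from one vertex to the other. $\Delta_u(d,n)$ denotes the maximum diameter of a pointed $d$-dimensional polyhedron (bounded or unbounded) with $n$ facets. Convention: $\Delta_u(0,0)=0$; also $\Delta_u(d,d)=0$. For $n=d$ the right-hand side is read with $0^x=0$ for $x>0$. *)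

(* Defs.v *)
From HB Require Import structures.
From mathcomp Require Import all_boot all_order all_algebra.
From mathcomp Require Import all_classical all_reals all_analysis.
Import Order.TTheory GRing.Theory Num.Theory.
Import numFieldNormedType.Exports.

Set Implicit Arguments.
Unset Strict Implicit.
Unset Printing Implicit Defensive.

Local Open Scope classical_set_scope.
Local Open Scope ring_scope.

Definition dot (R : realType) (m : nat) (a x : 'rV[R]_m) : R :=
  (a *m x^T) 0 0.

Definition closed_halfspace (R : realType) (m : nat) (H : set 'rV[R]_m) : Prop :=
  exists (a : 'rV[R]_m) (b : R), a != 0 /\ H = [set x | dot a x <= b].

Definition polyhedron (R : realType) (m : nat) (P : set 'rV[R]_m) : Prop :=
  exists (k : nat) (H : 'I_k -> set 'rV[R]_m),
    (forall i, closed_halfspace (H i)) /\ P = \bigcap_i H i.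

(* The empty set counts as affine, so that the affine hull of the empty set is
   empty and the empty set has no dimension in the sense of [has_dim]. *)
Definition is_affine (R : realType) (m : nat) (A : set 'rV[R]_m) : Prop :=
  forall (x y : 'rV[R]_m) (t : R), A x -> A y -> A (t *: x + (1 - t) *: y).

Definition affine_hull (R : realType) (m : nat) (S : set 'rV[R]_m) :
    set 'rV[R]_m :=
  smallest (@is_affine R m) S.

(* The direction space of the affine hull is the row space of [V]. *)
Definition has_dim (R : realType) (m : nat) (S : set 'rV[R]_m) (k : nat) : Prop :=
  exists (x0 : 'rV[R]_m) (V : 'M[R]_m),
    \rank V = k /\ affine_hull S = [set x | (x - x0 <= V)%MS].

(* [a = 0] is allowed, so [P] itself and the empty set are faces of [P]. *)
Definition face (R : realType) (m : nat) (P F : set 'rV[R]_m) : Prop :=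
  exists (a : 'rV[R]_m) (b : R),
    (forall x, P x -> dot a x <= b) /\ F = P `&` [set x | dot a x = b].

Definition vertex (R : realType) (m : nat) (P : set 'rV[R]_m) (v : 'rV[R]_m) :
    Prop :=
  face P [set v].

Definition edge (R : realType) (m : nat) (P E : set 'rV[R]_m) : Prop :=
  face P E /\ has_dim E 1.

Definition facet (R : realType) (m : nat) (P F : set 'rV[R]_m) : Prop :=
  face P F /\ exists k : nat, has_dim P k.+1 /\ has_dim F k.

Definition pointed (R : realType) (m : nat) (P : set 'rV[R]_m) : Prop :=
  exists v, vertex P v.

Definition segment (R : realType) (m : nat) (u v : 'rV[R]_m) : set 'rV[R]_m :=
  [set (1 - t) *: u + t *: v | t in `[0, 1]%classic].

(* Since an edge is 1-dimensional, [adjacent P u v] forces [u <> v]; unbounded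
   edges are not segments and give no adjacency. *)
Definition adjacent (R : realType) (m : nat) (P : set 'rV[R]_m)
    (u v : 'rV[R]_m) : Prop :=
  vertex P u /\ vertex P v /\ edge P (segment u v).

Definition walk (R : realType) (m : nat) (P : set 'rV[R]_m) (u v : 'rV[R]_m)
    (s : seq 'rV[R]_m) : Prop :=
  path (fun x y => `[< adjacent P x y >]) u s /\ last u s = v.

(* Equal to [+oo] when no walk joins [u] to [v]; in particular, a polyhedron
   with a disconnected graph would have diameter [+oo]. *)
Definition distance (R : realType) (m : nat) (P : set 'rV[R]_m)
    (u v : 'rV[R]_m) : \bar R :=
  ereal_inf [set ((size s)%:R)%:E | s in [set s | walk P u v s]].

Definition diameter (R : realType) (m : nat) (P : set 'rV[R]_m) : \bar R :=
  ereal_sup [set distance P p.1 p.2 | p in [set p | vertex P p.1 /\ vertex P p.2]].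

(* All diameters involved are natural numbers or [+oo], so a finite supremum is
   a maximum. The [d]-dimensional polyhedra range over all ambient spaces R^m. *)
Definition Delta_u (R : realType) (d n : nat) : \bar R :=
  ereal_sup [set delta | exists (m : nat) (P : set 'rV[R]_m),
    [/\ polyhedron P, pointed P, has_dim P d,
        ([set F | facet P F] #= `I_n)%card & delta = diameter P]].

Definition log2 (R : realType) (x : R) : R := ln x / ln 2.

(* Main.v *)
Require Import Defs.
From mathcomp Require Import all_boot all_order all_algebra.
From mathcomp Require Import all_classical all_reals all_analysis.
From mathcomp Require Import zify ring lra.
Import Order.TTheory GRing.Theory Num.Theory.
Import numFieldNormedType.Exports.

(** Let u, v be vertices at distance l of a pointed d-polyhedron with n facets,
    and put x = n - d.  Sort the vertices into l + 1 layers by their distance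
    from u.  Walking by the simplex method inside the smallest face containing
    two given vertices shows that whatever facets these two share are also
    shared by some vertex of every intermediate layer.  This property
    ([connected_T]) yields the Kalai-Kleitman recursion ([layers_halving]):
    cut off from either end as many layers as possible that meet at most half
    of the facets; each of the two ends, enlarged by one layer, meets more than
    half of the facets, so they have a facet s in common; every layer from one
    enlargement to the other then meets s, and s is a polyhedron of dimension
    d - 1 with fewer facets.  Every vertex lies on d facets or more, so the ends
    are empty unless x >= d, and the largest number h of layers satisfies
      h (d, x) <= h (d - 1, x) + [x >= d] 2 h (d, (x - d) / 2),
      h (1, x) <= x + 1.
    Degenerate vertices are handled by linear algebra: facets are replaced by
    the rows of an irredundant system of inequalities, and dimension by the
    corank of a set of rows ([layers_bound], [polyhedron_walk_bound]).

    The recursion is solved on dyadic scales x < 2 ^ j.  The condition x >= d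
    lets only min (d, 2 ^ j - 1) terms contribute, whence
    h <= 2 ^ (j + j (j + 1) / 2) for every d; from a level c on, Pascal's rule
    propagates this into
      h <= 2 ^ (c + c (c + 1) / 2) * 2 ^ i * 'C(d + i, i)   when x < 2 ^ (c + i).
    These two bounds are [layer_count].

    Take 2 ^ c about d and let L = ln d.  By the binomial theorem
    'C(d + i, i) <= s ^- i * (1 - s) ^- d for every s in ]0, 1[.  The choice
    s = L ^ 2 / (2 (ln 2) d) makes 2 / s = 4 (ln 2) d / L ^ 2, which is the
    wanted growth per doubling of x.  The start-up factor 2 ^ (c ^ 2 / 2) and
    the factor (1 - s) ^- d are then each about exp (L ^ 2 / (2 ln 2)), and
    their product is compensated by the c doublings from 1 to d, up to
    exp (O (L ln L)).  An arbitrarily small relative increase of the constant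
    4 ln 2 absorbs this error once i exceeds a multiple of L ln L; for smaller i
    the crude estimate 'C(d + i, i) <= (d + 1) ^ i suffices
    ([layer_count_high]). *)

Set Implicit Arguments.
Unset Strict Implicit.
Unset Printing Implicit Defensive.
Local Open Scope classical_set_scope.
Local Open Scope ring_scope.

(** * Rank and span of a family of rows *)

Section RowSpans.
Variables (F : fieldType) (m k : nat) (a : 'I_k -> 'rV[F]_m).
Implicit Types W T : {set 'I_k}.

Definition row_span W : 'M[F]_m := (\sum_(i in W) <<a i>>)%MS.
Definition row_rank W : nat := \rank (row_span W).
Definition row_closure W : {set 'I_k} := [set i | (a i <= row_span W)%MS].

Lemma row_span_subP p W (B : 'M[F]_(p, m)) :
  reflect (forall i, i \in W -> (a i <= B)%MS) (row_span W <= B)%MS.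
Proof.
apply: (iffP sumsmx_subP) => H i /H; by rewrite genmxE.
Qed.

Lemma row_in_span W i : i \in W -> (a i <= row_span W)%MS.
Proof. by move: i; apply/row_span_subP. Qed.

Lemma row_span_mono W T : W \subset T -> (row_span W <= row_span T)%MS.
Proof.
by move=> /fintype.subsetP WT; apply/row_span_subP => i /WT; exact: row_in_span.
Qed.

Lemma sub_row_closure W : W \subset row_closure W.
Proof. by apply/fintype.subsetP => i iW; rewrite inE row_in_span. Qed.

Lemma row_closure_mono W T : W \subset T -> row_closure W \subset row_closure T.
Proof.
by move=> WT; apply/fintype.subsetP => i; rewrite !inE => /submx_trans; apply;
  exact: row_span_mono.
Qed.

Lemma row_rank_mono W T : W \subset T -> (row_rank W <= row_rank T)%N.
Proof. by move=> /row_span_mono/mxrankS. Qed.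

Lemma row_rank_card W : (row_rank W <= #|W|)%N.
Proof.
rewrite /row_rank /row_span -sum1_card.
apply: leq_trans (mxrank_sum_leqif _) _; apply: leq_sum => i _ /=.
by rewrite genmxE rank_leq_row.
Qed.

Lemma row_rankU1 W i : i \notin row_closure W ->
  row_rank (i |: W) = (row_rank W).+1.
Proof.
move=> iW; have iW' : i \notin W.
  by apply: contra iW => /(fintype.subsetP (sub_row_closure W)).
have H : row_rank (i |: W) = \rank (a i + row_span W)%MS.
  rewrite /row_rank /row_span big_setU1 //=.
  by apply/eqP; rewrite eqn_leq !mxrankS //; apply: addsmxS; rewrite ?genmxE.
apply/eqP; rewrite eqn_leq H; apply/andP; split.
  apply: leq_trans (mxrank_adds_leqif _ _) _.
  by rewrite -(add1n (row_rank W)) leq_add ?rank_leq_row.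
apply: rank_ltmx; rewrite /ltmx addsmxSr /=.
by apply: contra iW; rewrite inE => /(submx_trans (addsmxSl _ _)).
Qed.

(** This is what replaces the count of the facets through a nondegenerate
    vertex: the rows outside the closure of [W] number at least the corank. *)
Lemma row_rank_leq_setD W T :
  (row_rank T <= row_rank W + #|T :\: row_closure W|)%N.
Proof.
apply: leq_trans (leq_add (leqnn _) (row_rank_card _)).
apply: leq_trans (mxrank_adds_leqif _ _); apply: mxrankS.
apply/row_span_subP => i iT.
have [iW|iW] := boolP (i \in row_closure W).
  by move: iW; rewrite inE => /submx_trans; apply; exact: addsmxSl.
by apply: submx_trans (addsmxSr _ _); apply: row_in_span; rewrite inE iW.
Qed.

End RowSpans.

(** * Connected layer families *)

(** [T v] is the set of symbols (rows) of the object [v], and [delta v] its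
    layer.  [connected_T] is all that remains of the edges of the polyhedron. *)
Section Layers.
Variables (F : fieldType) (m k : nat) (a : 'I_k -> 'rV[F]_m).
Variables (V : Type) (T : V -> {set 'I_k}) (delta : V -> nat).
Hypothesis rank_T : forall v, row_rank a (T v) = m.
Hypothesis layer_T : forall W v w, row_rank a W = m ->
  W \subset T v -> W \subset T w -> delta v = delta w.
Hypothesis connected_T : forall v w l, (delta v <= l <= delta w)%N ->
  exists x, delta x = l /\ T v :&: T w \subset T x.
Implicit Types W : {set 'I_k}.

(** Symbols in the closure of [W] are discarded because, once all rows of [W]
    are tight, they no longer cut down the dimension. *)
Definition active_symbols W p q : {set 'I_k} :=
  [set s | (s \notin row_closure a W) &&
    `[< exists v, [/\ (p <= delta v <= q)%N, W \subset T v & s \in T v] >]].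

Definition meets_layer W l := exists v, W \subset T v /\ delta v = l.

Lemma meets_layer_between W p q l : meets_layer W p -> meets_layer W q ->
  (p <= l <= q)%N -> meets_layer W l.
Proof.
move=> [v [Wv <-]] [w [Ww <-]] /connected_T [x [<- Hx]]; exists x; split=> //.
by apply: fintype.subset_trans Hx; rewrite finset.subsetI Wv.
Qed.

Lemma active_symbols_mono W p q p' q' : (p <= p')%N -> (q' <= q)%N ->
  active_symbols W p' q' \subset active_symbols W p q.
Proof.
move=> pp qq; apply/fintype.subsetP => s; rewrite !inE => /andP[-> /asboolP[v [H1 H2 H3]]].
by apply/asboolP; exists v; split=> //; lia.
Qed.

Lemma leq_card_active d W p q l : (row_rank a W + d)%N = m ->
  (p <= l <= q)%N -> meets_layer W l -> (d <= #|active_symbols W p q|)%N.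
Proof.
move=> rW pq [v [Wv dv]].
have h := row_rank_leq_setD a W (T v); rewrite rank_T in h.
have {h} : (d <= #|T v :\: row_closure a W|)%N by lia.
move=> /leq_trans; apply.
apply: subset_leq_card; apply/fintype.subsetP => s; rewrite !inE => /andP[-> sv] /=.
by apply/asboolP; exists v; rewrite dv.
Qed.

(** In corank one a single active symbol determines the object, so distinct
    layers use disjoint nonempty sets of active symbols. *)
Lemma layers_corank1 W p q : (row_rank a W).+1 = m -> (p <= q)%N ->
  meets_layer W p -> meets_layer W q -> (q - p < #|active_symbols W p q|)%N.
Proof.
move=> rW pq mp mq.
have Hs (l : 'I_(q - p).+1) : exists s : 'I_k, s \notin row_closure a W /\
    exists v, [/\ delta v = (p + l)%N, W \subset T v & s \in T v].
  have hl : (p <= p + l <= q)%N by have := ltn_ord l; lia.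
  have [v [Wv dv]] := meets_layer_between mp mq hl.
  have h := row_rank_leq_setD a W (T v); rewrite rank_T in h.
  have {h} : (0 < #|T v :\: row_closure a W|)%N by lia.
  case/card_gt0P => s; rewrite inE => /andP[sW sv].
  by exists s; split=> //; exists v.
have [f Hf] := boolp.choice Hs.
rewrite -[X in (X <= _)%N]card_ord -(card_imset predT (f := f)); last first.
  move=> l l' E; have [sW [v [dv Wv fv]]] := Hf l.
  have [_ [v' [dv' Wv' fv']]] := Hf l'.
  have : delta v = delta v'.
    apply: (@layer_T (f l |: W)); first by rewrite row_rankU1.
      by rewrite finset.subUset finset.sub1set fv.
    by rewrite finset.subUset finset.sub1set E fv'.
  by rewrite dv dv' => /addnI /val_inj.
apply: subset_leq_card; apply/fintype.subsetP => _ /imsetP[l _ ->].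
have [sW [v [dv Wv fv]]] := Hf l; rewrite inE sW /=.
by apply/asboolP; exists v; split=> //; have := ltn_ord l; lia.
Qed.

Lemma first_failure (P : pred nat) N : P N ->
  exists t, P t /\ forall u, t = u.+1 -> ~~ P u.
Proof.
move=> PN; have ex : exists t, P t by exists N.
case: (ex_minnP ex) => t Pt tmin; exists t; split=> // u tu.
by apply/negP => /tmin; rewrite tu ltnn.
Qed.

(** The Kalai-Kleitman argument.  [M] bounds the layers through one more symbol
    and [N] the blocks of layers that use at most half of the symbols. *)
Lemma layers_halving W p q M N : (p <= q)%N ->
  meets_layer W p -> meets_layer W q ->
  (forall s p' q', s \notin row_closure a W -> (p' <= q')%N ->
     meets_layer (s |: W) p' -> meets_layer (s |: W) q' ->
     (#|active_symbols (s |: W) p' q'| < #|active_symbols W p q|)%N ->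
     (q' - p' < M)%N) ->
  (forall p' q', (p' <= q')%N -> meets_layer W p' -> meets_layer W q' ->
     (2 * #|active_symbols W p' q'| <= #|active_symbols W p q|)%N ->
     (q' - p' < N)%N) ->
  (q - p < M + 2 * N)%N.
Proof.
move=> pq mp mq middle half; set n := #|_| in middle half.
(* [t] and [u] are the numbers of layers in the longest initial and final
   blocks that use at most half of the active symbols. *)
have [t [ta tmin]] := @first_failure
  (fun t => (q < p + t) || (n < 2 * #|active_symbols W p (p + t)|))%N
  (q - p).+1 ltac:(apply/orP; left; lia).
have [u [ub umin]] := @first_failure
  (fun u => (q < p + u) || (n < 2 * #|active_symbols W (q - u) q|))%N
  (q - p).+1 ltac:(apply/orP; left; lia).
have tN : (t <= N)%N.
  case: t ta tmin => // t _ /(_ t erefl); rewrite negb_or -!leqNgt => /andP[h1 h2].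
  have := half p (p + t)%N; rewrite leq_addr addKn; apply=> //.
  by apply: meets_layer_between mp mq _; rewrite leq_addr h1.
have uN : (u <= N)%N.
  case: u ub umin => // u _ /(_ u erefl); rewrite negb_or -!leqNgt => /andP[h1 h2].
  have := half (q - u)%N q; rewrite leq_subr subKn; last lia.
  by apply=> //; apply: meets_layer_between mp mq _; lia.
have [tuqp|] := leqP (t + u) (q - p); last lia.
have {}ta : (n < 2 * #|active_symbols W p (p + t)|)%N by move: ta; lia.
have {}ub : (n < 2 * #|active_symbols W (q - u) q|)%N by move: ub; lia.
have := cardsUI (active_symbols W p (p + t)) (active_symbols W (q - u) q).
have : (#|active_symbols W p (p + t) :|: active_symbols W (q - u) q| <= n)%N.
  by apply: subset_leq_card; rewrite finset.subUset !active_symbols_mono //; lia.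
move=> hU hUI; have : (0 < #|active_symbols W p (p + t) :&:
                          active_symbols W (q - u) q|)%N by lia.
(* [s] occurs in both enlarged ends, hence in all layers in between. *)
case/card_gt0P => s; rewrite !inE => /andP[/andP[sW /asboolP[v [dv Wv sv]]]].
move=> /andP[_ /asboolP[w [dw Ww sw]]].
have mv : meets_layer (s |: W) (delta v) by exists v; rewrite finset.subUset finset.sub1set sv.
have mw : meets_layer (s |: W) (delta w) by exists w; rewrite finset.subUset finset.sub1set sw.
have mp' : meets_layer (s |: W) (p + t) by apply: meets_layer_between mv mw _; lia.
have mq' : meets_layer (s |: W) (q - u) by apply: meets_layer_between mv mw _; lia.
have : (q - u - (p + t) < M)%N.
  have scl : s \notin row_closure a W by rewrite inE.
  apply: (middle s _ _ scl _ mp' mq'); first lia.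
  apply: proper_card; rewrite fintype.properE; apply/andP; split.
    apply/fintype.subsetP => i; rewrite !inE => /andP[icl /asboolP[x [dx Wx ix]]].
    rewrite (contra _ icl); last first.
      by have /fintype.subsetP/(_ i) := row_closure_mono a (finset.subsetU1 s W); rewrite !inE.
    apply/asboolP; exists x; split=> //; first lia.
    by apply: fintype.subset_trans Wx; exact: finset.subsetU1.
  apply/fintype.subsetPn; exists s.
    by rewrite inE scl; apply/asboolP; exists v; split=> //; lia.
  rewrite inE negb_and negbK; apply/orP; left.
  by apply: (fintype.subsetP (sub_row_closure _ _)); rewrite setU11.
lia.
Qed.

(** [H d j] stands for any solution of the recursion that bounds the number of
    layers in corank [d] with fewer than [d + 2 ^ j] symbols.  The halving step
    is required only for [d.+1 < 2 ^ j.+1]: with fewer symbols than twice the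
    corank, no layer fits into half of them. *)
Section Recursion.
Variable H : nat -> nat -> nat.
Hypothesis H1 : forall j, (2 ^ j <= H 1 j)%N.
Hypothesis Hmono : forall d j, (0 < d)%N -> (H d j <= H d.+1 j)%N.
Hypothesis Hrec : forall d j, (0 < d)%N -> (d.+1 < 2 ^ j.+1)%N ->
  (H d j.+1 + 2 * H d.+1 j <= H d.+1 j.+1)%N.

Theorem layers_bound d j W p q : (0 < d)%N -> (row_rank a W + d)%N = m ->
  (p <= q)%N -> meets_layer W p -> meets_layer W q ->
  (#|active_symbols W p q| < d + 2 ^ j)%N -> (q - p < H d j)%N.
Proof.
elim: d j W p q => // -[|d] IHd j W p q _ rW pq mp mq hn.
  rewrite addn1 in rW; have := layers_corank1 rW pq mp mq.
  have := H1 j; lia.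
elim/ltn_ind: j W p q rW pq mp mq hn => j IHj W p q rW pq mp mq hn.
have middle s p' q' : s \notin row_closure a W -> (p' <= q')%N ->
    meets_layer (s |: W) p' -> meets_layer (s |: W) q' ->
    (#|active_symbols (s |: W) p' q'| < #|active_symbols W p q|)%N ->
    (q' - p' < H d.+1 j)%N.
  move=> sW pq' mp' mq' hs; apply: (IHd j (s |: W)) => //; last lia.
  by rewrite row_rankU1 //; lia.
(* A vertex already uses [d.+2] active symbols, so a nonempty block using half
   of them forces their number to be at least twice the corank. *)
have half_large p' q' : (p' <= q')%N -> meets_layer W p' ->
    (2 * #|active_symbols W p' q'| <= #|active_symbols W p q|)%N ->
    (d.+2 < 2 ^ j)%N.
  move=> pq' mp' hh; have pp : (p' <= p' <= q')%N by rewrite leqnn.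
  have := leq_card_active rW pp mp'; lia.
have [dj|dj] := ltnP d.+2 (2 ^ j); last first.
  apply: leq_trans (Hmono j (ltn0Sn d)).
  rewrite -[leqRHS]addn0 -(muln0 2); apply: (@layers_halving W) => //.
  by move=> p' q' pq' mp' _ hh; have := half_large _ _ pq' mp' hh; lia.
case: j => [|j] in IHj hn middle half_large dj *; first by rewrite expn0 in dj.
apply: leq_trans (Hrec (ltn0Sn d) dj); apply: (@layers_halving W) => //.
move=> p' q' pq' mp' mq' hh; apply: (IHj j _ W) => //.
rewrite expnS in hn; lia.
Qed.
End Recursion.
End Layers.

(** * Orthogonality and the ratio test *)

Section Dot.
Variables (R : realType) (m : nat).
Implicit Types c x y z : 'rV[R]_m.

Lemma dotDr c x y : dot c (x + y) = dot c x + dot c y.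
Proof. by rewrite /dot linearD mulmxDr mxE. Qed.

Lemma dotZr c t x : dot c (t *: x) = t * dot c x.
Proof. by rewrite /dot linearZ /= -scalemxAr mxE. Qed.

Lemma dotBr c x y : dot c (x - y) = dot c x - dot c y.
Proof. by rewrite -scaleN1r dotDr dotZr mulN1r. Qed.

Lemma dot0r c : dot c 0 = 0.
Proof. by rewrite /dot trmx0 mulmx0 mxE. Qed.

Lemma dot_suml (I : finType) (A : {set I}) (c : I -> 'rV[R]_m) x :
  dot (\sum_(i in A) c i) x = \sum_(i in A) dot (c i) x.
Proof. by rewrite /dot mulmx_suml summxE. Qed.

Lemma dot_eq0_ker c z : (dot c z == 0) = (c <= kermx z^T)%MS.
Proof.
apply/eqP/sub_kermxP => [h|h]; last by rewrite /dot h mxE.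
by apply/matrixP => i j; rewrite !ord1 [RHS]mxE.
Qed.

Lemma exists_orthogonal p (A : 'M[R]_(p, m)) : (\rank A < m)%N ->
  exists2 z, z != 0 & forall c, (c <= A)%MS -> dot c z = 0.
Proof.
move=> rA; exists (nz_row (kermx A^T)).
  by rewrite nz_row_eq0 -mxrank_eq0 mxrank_ker mxrank_tr; lia.
move=> c cA; apply/eqP; rewrite dot_eq0_ker; apply: submx_trans cA _.
apply/sub_kermxP; apply: trmx_inj; rewrite trmx_mul trmxK trmx0.
by apply/sub_kermxP; exact: nz_row_sub.
Qed.

Variables (k : nat) (a : 'I_k -> 'rV[R]_m).
Implicit Types W : {set 'I_k}.

Definition orthogonal_to W z := forall i, i \in W -> dot (a i) z = 0.

Lemma orthogonal_span W z c : orthogonal_to W z ->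
  (c <= row_span a W)%MS -> dot c z = 0.
Proof.
move=> h /submx_trans H; apply/eqP; rewrite dot_eq0_ker; apply: H.
by apply/row_span_subP => i /h /eqP; rewrite dot_eq0_ker.
Qed.

Lemma orthogonal_ker W z :
  (z <= kermx (row_span a W)^T)%MS <-> orthogonal_to W z.
Proof.
split=> [/sub_kermxP h i iW|h].
  apply/eqP; rewrite dot_eq0_ker; apply: submx_trans (row_in_span a iW) _.
  by apply/sub_kermxP; apply: trmx_inj; rewrite trmx_mul trmxK trmx0.
apply/sub_kermxP; apply: trmx_inj; rewrite trmx_mul trmxK trmx0.
apply/sub_kermxP/row_span_subP => i /h /eqP; by rewrite dot_eq0_ker.
Qed.

Lemma rank_orthogonal W : \rank (kermx (row_span a W)^T) = (m - row_rank a W)%N.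
Proof. by rewrite mxrank_ker mxrank_tr. Qed.

Lemma orthogonal_full W z : row_rank a W = m -> orthogonal_to W z -> z = 0.
Proof.
move=> rW /orthogonal_ker; suff /eqP -> : kermx (row_span a W)^T == 0.
  by rewrite submx0 => /eqP.
by rewrite -mxrank_eq0 rank_orthogonal rW subnn.
Qed.

Lemma orthogonal_rank_lt W z : z != 0 -> orthogonal_to W z ->
  (row_rank a W < m)%N.
Proof.
move=> z0 oz; rewrite ltn_neqAle rank_leq_col andbT.
by apply: contra_neq z0 => /orthogonal_full; exact.
Qed.

Lemma orthogonal_line W y z : (row_rank a W).+1 = m -> y != 0 ->
  orthogonal_to W y -> orthogonal_to W z -> exists t, z = t *: y.
Proof.
move=> rW y0 /orthogonal_ker oy /orthogonal_ker oz.
apply/sub_rVP; apply: submx_trans oz _.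
by rewrite -(geq_leqif (mxrank_leqif_sup oy)) rank_orthogonal rank_rV y0; lia.
Qed.
End Dot.

Section RatioTest.
Variables (R : realFieldType) (I : finType) (A : {set I}) (slack slope : I -> R).

(** Moving along a line, the first constraint to become tight is the one with
    the smallest ratio of slack to slope among the increasing ones. *)
Lemma ratio_test i0 : (forall i, i \in A -> 0 <= slack i) ->
  i0 \in A -> 0 < slope i0 ->
  exists t i, [/\ 0 <= t, i \in A, 0 < slope i, t * slope i = slack i &
    forall j, j \in A -> t * slope j <= slack j].
Proof.
move=> slack0 Ai0 slope0.
have Pi0 : (i0 \in A) && (0 < slope i0) by rewrite Ai0.
case: (@arg_minP _ _ _ i0 (fun i => (i \in A) && (0 < slope i))
         (fun i => slack i / slope i) Pi0) => i /andP[Ai si] imin.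
exists (slack i / slope i), i; split=> //.
- by rewrite divr_ge0 ?slack0 // ltW.
- by rewrite divfK // gt_eqF.
move=> j Aj; have [sj|sj] := ltP 0 (slope j).
  by rewrite -ler_pdivlMr //; apply: imin; rewrite Aj.
apply: le_trans (slack0 j Aj); rewrite mulr_ge0_le0 //.
by rewrite divr_ge0 ?slack0 // ltW.
Qed.
End RatioTest.

(** * Polyhedra given by rows: faces, vertices and edges *)

Section Dimension.
Variables (R : realType) (m : nat).

Lemma has_dim_unique (S : set 'rV[R]_m) d d' : has_dim S d -> has_dim S d' -> d = d'.
Proof.
move=> [x [V [<- hV]]] [y [W [<- hW]]].
have sub (x1 y1 : 'rV[R]_m) (V1 W1 : 'M[R]_m) : affine_hull S = [set z | (z - x1 <= V1)%MS] ->
    affine_hull S = [set z | (z - y1 <= W1)%MS] -> (V1 <= W1)%MS.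
  move=> h1 h2; have E : [set z | (z - x1 <= V1)%MS] `<=` [set z | (z - y1 <= W1)%MS].
    by rewrite -h1 -h2.
  apply/row_subP => i.
  have /= e1 := E (row i V1 + x1); rewrite addrK row_sub in e1.
  have /= e2 := E x1; rewrite subrr sub0mx in e2.
  have -> : row i V1 = (row i V1 + x1 - y1) - (x1 - y1).
    by rewrite opprB addrA subrK addrK.
  by apply: addmx_sub (e1 isT) _; rewrite eqmx_opp; exact: e2.
apply/eqP; rewrite eqn_leq; apply/andP.
have VW := sub _ _ _ _ hV hW; have WV := sub _ _ _ _ hW hV.
by rewrite (mxrankS VW) (mxrankS WV).
Qed.

Variables (k : nat) (a : 'I_k -> 'rV[R]_m) (b : 'I_k -> R).
Implicit Types (W T : {set 'I_k}) (u v x y z : 'rV[R]_m).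

Definition row_polyhedron : set 'rV[R]_m := [set x | forall i, dot (a i) x <= b i].
Definition tight_rows x : {set 'I_k} := [set i | dot (a i) x == b i]%SET.
Definition tight_face W : set 'rV[R]_m :=
  [set x | row_polyhedron x /\ W \subset tight_rows x].
Notation P := row_polyhedron.

Lemma tight_subP W x :
  reflect (forall i, i \in W -> dot (a i) x = b i) (W \subset tight_rows x).
Proof.
by apply: (iffP fintype.subsetP) => h i /h; rewrite inE => /eqP.
Qed.

Lemma tight_sub_orthogonal W x y : W \subset tight_rows x ->
  W \subset tight_rows y -> orthogonal_to a W (y - x).
Proof.
by move=> /tight_subP hx /tight_subP hy i iW; rewrite dotBr hx // hy // subrr.
Qed.

Lemma tight_sub_shift W x y t : W \subset tight_rows x ->
  orthogonal_to a W y -> W \subset tight_rows (x + t *: y).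
Proof.
move=> /tight_subP hx hy; apply/tight_subP => i iW.
by rewrite dotDr dotZr hx // hy // mulr0 addr0.
Qed.

Lemma exists_feasible_step x y : P x ->
  (forall i, i \in tight_rows x -> dot (a i) y <= 0) ->
  exists2 t, 0 < t & P (x + t *: y).
Proof.
move=> Px ty.
have [/existsP[i0 si0]|/existsPn none] := boolP [exists i, 0 < dot (a i) y]; last first.
  exists 1 => // i; rewrite dotDr dotZr mul1r.
  by have := none i; rewrite -leNgt => h; have := Px i; lra.
have [||t [i [t0 _ si ti tj]]] := @ratio_test R _ [set: 'I_k]%SET
  (fun i => b i - dot (a i) x) (fun i => dot (a i) y) i0 _ _ si0; rewrite ?inE //.
  by move=> i _; rewrite subr_ge0.
exists t.
  rewrite lt_neqAle t0 andbT; apply/eqP => t0'; move: si; rewrite ltNge ty //.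
  by rewrite inE; have := ti; rewrite -t0' mul0r => /esym/eqP; rewrite subr_eq0 eq_sym.
by move=> j; rewrite dotDr dotZr; have := tj j; rewrite inE => /(_ isT); lra.
Qed.

(** The sum of the inequalities of [W] is an equality only where each of them
    is one. *)
Lemma row_face W : face P (tight_face W).
Proof.
exists (\sum_(i in W) a i), (\sum_(i in W) b i); split=> [x Px|].
  by rewrite dot_suml; apply: ler_sum => i _; exact: Px.
apply/seteqP; split=> x /= [Px].
  by move=> /tight_subP h; split=> //; rewrite dot_suml; apply: eq_bigr.
move=> hs; split=> //; apply/tight_subP => i iW.
have := @psumr_eq0P R _ (fun i => i \in W) (fun i => b i - dot (a i) x).
move=> /(_ _ _ i iW) h; apply/esym/eqP; rewrite -subr_eq0; apply/eqP/h => [j _|].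
  by rewrite subr_ge0.
by rewrite sumrB -dot_suml hs subrr.
Qed.

(** From a point [z] where only the rows of [W] are tight one can move a little
    in every direction orthogonal to [W], so the affine hull is not smaller. *)
Lemma affine_hull_tight W z : P z -> tight_rows z = W ->
  affine_hull (tight_face W) = [set x | (x - z <= kermx (row_span a W)^T)%MS].
Proof.
move=> Pz tz; have Wz : W \subset tight_rows z by rewrite tz.
apply/seteqP; split.
  apply: smallest_sub => [x y t|x [_ Wx]] /=; last first.
    by apply/orthogonal_ker; exact: tight_sub_orthogonal.
  move=> hx hy; have -> : t *: x + (1 - t) *: y - z = t *: (x - z) + (1 - t) *: (y - z).
    by rewrite !scalerBr addrACA -opprD -scalerDl [t + _]addrC subrK scale1r.
  by rewrite addmx_sub // scalemx_sub.
move=> x /= /orthogonal_ker ox A [affA subA].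
have [t t0 Pt] : exists2 t, 0 < t & P (z + t *: (x - z)).
  by apply: exists_feasible_step => // i; rewrite tz => /ox ->.
have A1 : A (z + t *: (x - z)) by apply: subA; split=> //; exact: tight_sub_shift.
have A0 : A z by apply: subA.
have := affA _ _ t^-1 A1 A0; congr A.
rewrite scalerDr scalerA mulVf ?gt_eqF // scale1r scalerBl scale1r.
by rewrite addrC addrA subrK addrC subrK.
Qed.

Lemma has_dim_tight W z : P z -> tight_rows z = W ->
  has_dim (tight_face W) (m - row_rank a W).
Proof.
move=> Pz tz; exists z, (kermx (row_span a W)^T).
by rewrite rank_orthogonal; split=> //; exact: affine_hull_tight.
Qed.

(** If the tight rows had rank less than [m], the point could move both ways
    along a line inside the polyhedron, and no functional would expose it. *)
Lemma vertexP v : vertex P v <-> P v /\ row_rank a (tight_rows v) = m.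
Proof.
split=> [[c [beta [hc hv]]]|[Pv rv]]; last first.
  rewrite /vertex; suff -> : [set v] = tight_face (tight_rows v) by exact: row_face.
  apply/seteqP; split=> [_ ->|x [Px tx]] //=.
  by apply/subr0_eq/(orthogonal_full rv); exact: tight_sub_orthogonal.
have [Pv cv] : P v /\ dot c v = beta.
  by have : (P `&` [set x | dot c x = beta]) v by rewrite -hv.
split=> //; apply/eqP; rewrite eqn_leq rank_leq_col leqNgt /=; apply/negP.
move=> /exists_orthogonal[z z0 oz].
have {}oz : orthogonal_to a (tight_rows v) z.
  by move=> i iv; apply: oz; exact: row_in_span.
have [t t0 Pt] : exists2 t, 0 < t & P (v + t *: z).
  by apply: exists_feasible_step => // i /oz ->.
have [s s0 Ps] : exists2 s, 0 < s & P (v + s *: (- z)).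
  by apply: exists_feasible_step => // i /oz h; rewrite -scaleN1r dotZr h mulr0.
have := hc _ Pt; have := hc _ Ps; rewrite scalerN -scaleNr !dotDr !dotZr cv => h1 h2.
have cz : dot c z = 0 by nra.
have : (P `&` [set x | dot c x = beta]) (v + t *: z).
  by split=> //=; rewrite dotDr dotZr cz mulr0 addr0.
rewrite -hv /= -[RHS]addr0 => /addrI /eqP; rewrite scaler_eq0 (negPf z0) orbF.
by rewrite gt_eqF.
Qed.

Lemma vertex_in v : vertex P v -> P v.
Proof. by case/vertexP. Qed.

Lemma vertex_rank v : vertex P v -> row_rank a (tight_rows v) = m.
Proof. by case/vertexP. Qed.

Lemma tight_full_inj W v w : row_rank a W = m ->
  W \subset tight_rows v -> W \subset tight_rows w -> v = w.
Proof.
move=> rW hv hw; apply/esym/subr0_eq/(orthogonal_full rW).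
exact: tight_sub_orthogonal.
Qed.

(** A feasible direction improving [c] can be taken along an edge: among such
    directions take one orthogonal to as many tight rows as possible.  If these
    rows had corank two or more, one could add a multiple of a vector
    orthogonal to them and to [c] until a further row becomes orthogonal. *)
Lemma exists_extreme_direction u c y W : row_rank a (tight_rows u) = m ->
  W \subset tight_rows u -> orthogonal_to a W y ->
  (forall i, i \in tight_rows u -> dot (a i) y <= 0) -> 0 < dot c y ->
  exists (Z : {set 'I_k}) z, [/\ [/\ W \subset Z, Z \subset tight_rows u & (row_rank a Z).+1 = m],
    orthogonal_to a Z z, (forall i, i \in tight_rows u -> i \notin Z -> dot (a i) z < 0) &
    0 < dot c z].
Proof.
move=> ru Wu.
have [N] := ubnP #|[set i in tight_rows u | dot (a i) y != 0]%SET|.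
elim: N y => // N IHN y; rewrite ltnS => hN oy fy cy.
set Z := [set i in tight_rows u | dot (a i) y == 0]%SET.
have y0 : y != 0 by apply: contraTneq cy => ->; rewrite dot0r ltxx.
have oZ : orthogonal_to a Z y by move=> i; rewrite inE => /andP[_ /eqP].
have Zu : Z \subset tight_rows u by apply/fintype.subsetP => i; rewrite inE => /andP[].
have rZ := orthogonal_rank_lt y0 oZ.
have [rZm|rZm] := eqVneq (row_rank a Z).+1 m.
  exists Z, y; split=> //; [split=> //|].
    apply/fintype.subsetP => i iW; rewrite inE (fintype.subsetP Wu) //=.
    by rewrite oy.
  by move=> i iu; rewrite inE iu /= lt_neqAle => ->; rewrite fy.
have : (\rank (row_span a Z + c)%MS < m)%N.
  apply: leq_ltn_trans (mxrank_adds_leqif _ _) _.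
  have := rank_leq_row c; rewrite -/(row_rank a Z); lia.
move=> /exists_orthogonal[z0 z0n0 oz0].
have [z [zn0 oz cz] [i iu iz]] : exists2 z, [/\ z != 0, orthogonal_to a Z z & dot c z = 0] &
    exists2 i, i \in tight_rows u & 0 < dot (a i) z.
  have oz : orthogonal_to a Z z0.
    by move=> i iZ; apply/oz0/(submx_trans _ (addsmxSl _ _)); exact: row_in_span.
  have cz : dot c z0 = 0 by apply/oz0/addsmxSr.
  have : exists2 i, i \in tight_rows u & dot (a i) z0 != 0.
    apply/exists_inP; apply: contraNT z0n0; rewrite negb_exists_in => /forall_inP h.
    by apply/eqP/(orthogonal_full ru) => i /h; rewrite negbK => /eqP.
  case=> i iu; case: (ltgtP (dot (a i) z0) 0) => // iz _; last first.
    by exists z0 => //; exists i.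
  exists (- z0); last by exists i; rewrite // -scaleN1r dotZr mulN1r oppr_gt0.
  split; rewrite ?oppr_eq0 //; rewrite -scaleN1r; last by rewrite dotZr cz mulr0.
  by move=> j jZ; rewrite dotZr oz ?mulr0.
have [|t [l [t0 lu lz tl tj]]] := @ratio_test R _ (tight_rows u)
  (fun i => - dot (a i) y) (fun i => dot (a i) z) i _ iu iz.
  by move=> j ju; rewrite oppr_ge0 fy.
have oyz : orthogonal_to a Z (y + t *: z).
  by move=> j jZ; rewrite dotDr dotZr oZ // oz // mulr0 addr0.
apply: (IHN (y + t *: z)).
- apply: leq_trans hN; apply: proper_card; rewrite fintype.properE; apply/andP; split.
    apply/fintype.subsetP => j; rewrite !inE => /andP[ju]; rewrite ju /=.
    by apply: contra => jy; rewrite oyz // !inE ju jy.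
  apply/fintype.subsetPn; exists l.
    rewrite !inE in lu *; rewrite lu /=; apply: contraTN lz => ly.
    by rewrite oz ?ltxx // !inE lu ly.
  by rewrite inE lu /= dotDr dotZr tl subrr eqxx.
- move=> j jW; apply: oyz; rewrite inE (fintype.subsetP Wu) //=.
  by rewrite oy.
- by move=> j ju; rewrite dotDr dotZr; have := tj _ ju; lra.
- by rewrite dotDr dotZr cz mulr0 addr0.
Qed.

(** The simplex step.  Starting from the direction [v - u] keeps the rows of [W],
    tight at both ends, tight along the whole edge. *)
Lemma exists_improving_neighbour u v c beta W :
  vertex P u -> P v -> W \subset tight_rows u -> W \subset tight_rows v ->
  (forall x, P x -> dot c x <= beta) -> dot c u < dot c v ->
  exists w, [/\ Defs.adjacent P u w, W \subset tight_rows w & dot c u < dot c w].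
Proof.
move=> Vu Pv Wu Wv hc cuv; have Pu := vertex_in Vu; have ru := vertex_rank Vu.
have [|||Z [y [[WZ Zu rZ] oy negy cy]]] :=
    @exists_extreme_direction u c (v - u) W ru Wu.
- exact: tight_sub_orthogonal.
- by move=> i; rewrite inE => /eqP iu; rewrite dotBr iu subr_le0.
- by rewrite dotBr subr_gt0.
have y0 : y != 0 by apply: contraTneq cy => ->; rewrite dot0r ltxx.
have fy i : i \in tight_rows u -> dot (a i) y <= 0.
  have [/oy -> //|iZ iu] := boolP (i \in Z); exact/ltW/negy.
(* Some row increases along [y], or [c] would be unbounded on the ray. *)
have [i0 si0] : exists i, 0 < dot (a i) y.
  apply/existsP; apply: contraT => /existsPn none.
  have : P (u + ((beta - dot c u) / dot c y + 1) *: y).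
    move=> i; rewrite dotDr dotZr; apply: le_trans (Pu i).
    rewrite gerDl mulr_ge0_le0 //; last by have := none i; rewrite -leNgt.
    by rewrite addr_ge0 // divr_ge0 ?ltW // subr_gt0 (lt_le_trans cuv) // hc.
  move=> /hc; rewrite dotDr dotZr mulrDl divfK ?gt_eqF //; lra.
have [||t [l [t0 _ ly tl tj]]] := @ratio_test R _ [set: 'I_k]%SET
  (fun i => b i - dot (a i) u) (fun i => dot (a i) y) i0 _ _ si0; rewrite ?inE //.
  by move=> i _; rewrite subr_ge0.
have lu : l \notin tight_rows u by apply: contraTN ly => /fy; rewrite -leNgt.
have {}t0 : 0 < t.
  rewrite lt_neqAle t0 andbT; apply/eqP => t0'; move: lu.
  by rewrite inE; have := tl; rewrite -t0' mul0r => /esym/eqP; rewrite subr_eq0 eq_sym => ->.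
set w := u + t *: y.
have Pw : P w by move=> j; rewrite dotDr dotZr; have := tj j; rewrite inE => /(_ isT); lra.
have Zw : Z \subset tight_rows w by exact: tight_sub_shift.
have lw : l \in tight_rows w by rewrite inE dotDr dotZr tl addrC subrK.
have lZ : l \notin row_closure a Z.
  by rewrite inE; apply: contraTN ly => /(orthogonal_span oy) ->; rewrite ltxx.
have Vw : vertex P w.
  apply/vertexP; split=> //; apply/eqP; rewrite eqn_leq rank_leq_col /= -[leqLHS]rZ.
  rewrite -(row_rankU1 lZ); apply: row_rank_mono.
  by rewrite finset.subUset finset.sub1set lw.
have sgE s : (1 - s) *: u + s *: w = u + (s * t) *: y.
  by rewrite scalerDr scalerA addrA -scalerDl subrK scale1r.
have segment_face : segment u w = tight_face Z.
  apply/seteqP; split=> [_ [s /= s01 <-]|x [Px Zx]].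
    rewrite sgE; split; last exact: tight_sub_shift.
    move: s01; rewrite in_itv /= => /andP[s0 s1] i.
    have := Pu i; have := Pw i; rewrite !dotDr !dotZr => h1 h2; nra.
  have [s xs] := orthogonal_line rZ y0 oy (tight_sub_orthogonal Zu Zx).
  have {}xs : x = u + s *: y by rewrite -xs addrC subrK.
  have nuZ : ~~ (tight_rows u \subset Z).
    apply/negP => uZ; have h := row_rank_mono a uZ.
    have := leq_trans (leq_trans (eq_leq rZ) (eq_leq (esym ru))) h.
    by rewrite ltnn.
  have /fintype.subsetPn[i iu iZ] := nuZ.
  have s0 : 0 <= s.
    have := Px i; rewrite xs dotDr dotZr; move: (iu); rewrite inE => /eqP ->.
    have := negy _ iu iZ => h1 h2; rewrite leNgt; apply/negP => h3; nra.
  have st : s <= t.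
    have := Px l; rewrite xs dotDr dotZr -lerBrDl -tl => h; nra.
  exists (s / t); last by rewrite sgE divfK ?gt_eqF.
  by rewrite /= in_itv /= divr_ge0 ?(ltW t0) //= ler_pdivrMr // mul1r.
exists w; split=> //.
- split=> //; split=> //; split; first by rewrite segment_face; exact: row_face.
  have dimZ : (m - row_rank a Z)%N = 1%N.
    have succ_sub r n : r.+1 = n -> (n - r)%N = 1%N by move=> <-; rewrite subSnn.
    exact: succ_sub rZ.
  rewrite segment_face -[X in has_dim _ X]dimZ.
  (* At the midpoint of the edge only the rows of [Z] are tight. *)
  have Zm : Z \subset tight_rows (u + (2^-1 * t) *: y) by exact: tight_sub_shift.
  apply: (has_dim_tight (z := u + (2^-1 * t) *: y)).
    rewrite -sgE; suff : tight_face Z ((1 - 2^-1) *: u + 2^-1 *: w) by case.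
    by rewrite -segment_face; exists 2^-1 => //=; rewrite in_itv /=; lra.
  apply/eqP; rewrite finset.eqEsubset Zm andbT; apply/fintype.subsetP => i.
  rewrite inE dotDr dotZr => /eqP im; apply: contraT => iZ.
  have := Pu i; have := Pw i; rewrite dotDr dotZr => h1 h2.
  have iu : i \in tight_rows u by rewrite inE; apply/eqP; lra.
  have := negy _ iu iZ; move: iu; rewrite inE => /eqP iu h3; nra.
- exact: fintype.subset_trans Zw.
- by rewrite dotDr dotZr ltrDl mulr_gt0.
Qed.

End Dimension.

(** * From polyhedra to layers *)

Section Walks.
Variables (R : realType) (m k : nat) (a : 'I_k -> 'rV[R]_m) (b : 'I_k -> R).
Notation P := (row_polyhedron a b).
Notation tight := (tight_rows a b).

(** The simplex method towards a functional exposing [v] ends at [v], because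
    the vertices above the current one become fewer at every step. *)
Lemma exists_walk_in_face (W : {set 'I_k}) u v : vertex P u -> vertex P v ->
  W \subset tight u -> W \subset tight v ->
  exists s, walk P u v s /\ all (fun x => W \subset tight x) (u :: s).
Proof.
move=> Vu Vv Wu Wv; have [c [beta [hc hv]]] := Vv.
have [Pv cv] : P v /\ dot c v = beta.
  by have : (P `&` [set x | dot c x = beta]) v by rewrite -hv.
pose above x : {set {set 'I_k}} :=
  [set T | `[< exists w, [/\ vertex P w, tight w = T & dot c x < dot c w] >]]%SET.
have [N] := ubnP #|above u|.
elim: N u Vu Wu => // N IHN u Vu Wu; rewrite ltnS => hN.
have [->|uv] := eqVneq u v; first by exists [::]; rewrite /= Wv.
have cuv : dot c u < dot c v.
  rewrite cv lt_neqAle hc ?andbT; last exact: vertex_in Vu.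
  apply: contra_neq uv => cu.
  by have : [set v] u by rewrite hv; split=> //; exact: vertex_in Vu.
have hcv x : P x -> dot c x <= beta by exact: hc.
have [w [uw Ww cw]] := exists_improving_neighbour Vu Pv Wu Wv hcv cuv.
have Vw : vertex P w by case: uw => _ [].
have [|s [[ps ls] Ws]] := IHN w Vw Ww.
  apply: leq_trans hN; apply: proper_card; rewrite fintype.properE; apply/andP; split.
    apply/fintype.subsetP => T; rewrite !inE => -[x [Vx tx cx]].
    by exists x; split=> //; exact: lt_trans cw cx.
  apply/fintype.subsetPn; exists (tight w).
    by rewrite !inE; exists w.
  rewrite !inE; apply/negP => /asboolP[x [Vx tx cx]].
  have xw : x = w.
    by apply: tight_full_inj (vertex_rank Vw) _ _ => //; rewrite tx.
  by rewrite xw ltxx in cx.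
exists (w :: s); split; last by rewrite /= Wu -[X in X && _]/(_ \subset _) in Ws *.
by split=> //=; rewrite ps andbT; apply/asboolP.
Qed.

Lemma path_hits_level (X : eqType) (e : rel X) (delta : X -> nat) x s l :
  (forall y z, y \in x :: s -> e y z -> (delta z <= (delta y).+1)%N) ->
  path e x s -> (delta x <= l <= delta (last x s))%N ->
  exists2 y, y \in x :: s & delta y = l.
Proof.
elim: s x => [|y s IHs] x he /=.
  by move=> _ xl; exists x; rewrite ?mem_head //; lia.
move=> /andP[xy ys] xl; have [lx|lx] := eqVneq (delta x) l.
  by exists x; rewrite ?mem_head.
have := he x y (mem_head _ _) xy => yx.
have [| |z zs zl] := IHs y _ ys; [|lia|].
  by move=> y' z' h; apply: he; rewrite in_cons h orbT.
by exists z; rewrite // in_cons zs orbT.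
Qed.

Lemma exists_graph_distance u : vertex P u -> exists delta : 'rV[R]_m -> nat,
  forall w, vertex P w ->
    (exists2 s, walk P u w s & size s = delta w) /\
    (forall s, walk P u w s -> (delta w <= size s)%N).
Proof.
move=> Vu.
suff /boolp.choice[delta hd] : forall w, exists n, vertex P w ->
    (exists2 s, walk P u w s & size s = n) /\
    (forall s, walk P u w s -> (n <= size s)%N) by exists delta.
move=> w; have [Vw|nVw] := pselect (vertex P w); last by exists 0%N.
have ex : exists n, `[< exists2 s, walk P u w s & size s = n >].
  have [s [us _]] := exists_walk_in_face Vu Vw (finset.sub0set _) (finset.sub0set _).
  by exists (size s); apply/asboolP; exists s.
case: (ex_minnP ex) => n /asboolP hn nmin; exists n => _; split=> // s us.
by apply: nmin; apply/asboolP; exists s.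
Qed.

(** [E] consists of the rows that are tight on the whole polyhedron, so that [d]
    is its dimension and the other rows correspond to its facets. *)
Section Bound.
Variables (E : {set 'I_k}) (d : nat) (H : nat -> nat -> nat).
Hypothesis rank_E : (row_rank a E + d)%N = m.
Hypothesis tight_E : forall x, P x -> E \subset tight x.
Hypothesis d_gt0 : (0 < d)%N.
Hypothesis H1 : forall j, (2 ^ j <= H 1 j)%N.
Hypothesis Hmono : forall d j, (0 < d)%N -> (H d j <= H d.+1 j)%N.
Hypothesis Hrec : forall d j, (0 < d)%N -> (d.+1 < 2 ^ j.+1)%N ->
  (H d j.+1 + 2 * H d.+1 j <= H d.+1 j.+1)%N.

Lemma row_walk_bound j u v : vertex P u -> vertex P v ->
  (#|~: E| < d + 2 ^ j)%N -> exists2 s, walk P u v s & (size s < H d j)%N.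
Proof.
move=> Vu Vv hE; have [delta hd] := exists_graph_distance Vu.
have delta_adj x y : vertex P x -> Defs.adjacent P x y ->
    (delta y <= (delta x).+1)%N.
  move=> Vx xy; have Vy : vertex P y by case: xy => _ [].
  have [[s [ps ls] <-] _] := hd _ Vx; have [_ hy] := hd _ Vy.
  have -> : (size s).+1 = size (rcons s y) by rewrite size_rcons.
  by apply: hy; split; rewrite ?last_rcons // rcons_path ps ls /=; apply/asboolP.
have delta_u : delta u = 0%N.
  by have [_ /(_ [::])] := hd _ Vu; rewrite leqn0 => h; apply/eqP/h.
have [[s us sv] _] := hd _ Vv; exists s => //; rewrite sv -[delta v]subn0.
pose V := {x | vertex P x}.
pose T (x : V) := tight (sval x).
pose dl (x : V) := delta (sval x).
apply: (@layers_bound _ _ _ a V T dl _ _ _ H H1 Hmono Hrec d j E) => //.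
- by move=> [x Vx]; exact: vertex_rank.
- move=> W [x Vx] [y Vy] rW Wx Wy; rewrite /dl /=.
  by have -> : x = y := tight_full_inj rW Wx Wy.
- move=> [x Vx] [y Vy] l xyl.
  have [t [[pt lt] Wt]] := exists_walk_in_face Vx Vy (finset.subsetIl _ _) (finset.subsetIr _ _).
  have Vt z : z \in x :: t -> vertex P z.
    rewrite in_cons => /predU1P[-> //|]; elim: t x {Vx xyl lt Wt} pt => // z' t IHt x.
    move=> /= /andP[/asboolP[_ [Vz' _]] pt]; rewrite in_cons => /predU1P[-> //|].
    exact: IHt pt.
  have [| |z zt zl] := path_hits_level (delta := delta) (l := l) _ pt.
  + by move=> z z' /Vt Vz /asboolP; exact: delta_adj.
  + by rewrite lt.
  exists (exist _ z (Vt z zt)); split=> //.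
  by move/allP: Wt => /(_ z zt).
- by exists (exist _ u Vu); split=> //; apply/tight_E/vertex_in.
- by exists (exist _ v Vv); split=> //; apply/tight_E/vertex_in.
- apply: leq_ltn_trans hE; apply: subset_leq_card; apply/fintype.subsetP => i.
  rewrite !inE => /andP[+ _]; apply: contra => iE; exact: row_in_span.
Qed.
End Bound.
End Walks.

(** * Irredundant rows define facets *)

Section Facets.
Variables (R : realType) (m : nat).

(** In a description with the least number of rows, no row can be dropped. *)
Lemma irredundant_rows (P : set 'rV[R]_m) : polyhedron P ->
  exists k (a : 'I_k -> 'rV[R]_m) (b : 'I_k -> R), P = row_polyhedron a b /\
    forall i, exists2 y, b i < dot (a i) y & forall j, j != i -> dot (a j) y <= b j.
Proof.
move=> [k0 [H0 [hH0 PH0]]].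
have ex : exists k, `[< exists (a : 'I_k -> 'rV[R]_m) (b : 'I_k -> R),
    P = row_polyhedron a b >].
  have [c hc] := boolp.choice hH0; have [e he] := boolp.choice hc.
  exists k0; apply/asboolP; exists c, e; rewrite PH0; apply/seteqP.
  split=> x /= hx i; first by have := hx i I; have [_ ->] := he i.
  by move=> _; have [_ ->] := he i; exact: hx.
case: (ex_minnP ex) => k /asboolP[a [b Pab]] kmin.
exists k, a, b; split=> // i; apply: contrapT => nex.
case: k a b Pab kmin i nex => [|k] a b Pab kmin i nex; first by case: i nex.
suff : (k.+1 <= k)%N by rewrite ltnn.
apply: kmin; apply/asboolP; exists (a \o lift i), (b \o lift i).
rewrite Pab; apply/seteqP; split=> [x hx j|x hx]; first exact: hx.
have hx' j : j != i -> dot (a j) x <= b j.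
  by case: (unliftP i j) => [j' ->|->]; [move=> _; exact: hx|rewrite eqxx].
move=> j; have [->|/hx' //] := eqVneq j i.
by rewrite leNgt; apply/negP => h; apply: nex; exists x.
Qed.

Variables (k : nat) (a : 'I_k -> 'rV[R]_m) (b : 'I_k -> R).
Notation P := (row_polyhedron a b).
Notation tight := (tight_rows a b).

(** Take a point with the fewest tight rows: averaging it with any other point
    of the polyhedron cannot lose a tight row. *)
Lemma exists_relative_interior x : P x ->
  exists2 z, P z & forall y, P y -> tight z \subset tight y.
Proof.
have [N] := ubnP #|tight x|.
elim: N x => // N IHN x; rewrite ltnS => hN Px.
have [hx|] := pselect (forall y, P y -> tight x \subset tight y); first by exists x.
move=> /existsNP[y /not_implyP[Py /negP/fintype.subsetPn[i ix iy]]].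
have tE j : j \in tight (2^-1 *: x + 2^-1 *: y) -> (j \in tight x) && (j \in tight y).
  rewrite !inE dotDr !dotZr => /eqP h; have := Px j; have := Py j => h1 h2.
  by apply/andP; split; apply/eqP; lra.
apply: (IHN (2^-1 *: x + 2^-1 *: y)).
  apply: leq_trans hN; apply: proper_card; rewrite fintype.properE; apply/andP; split.
    by apply/fintype.subsetP => j /tE/andP[].
  by apply/fintype.subsetPn; exists i => //; apply/negP => /tE/andP[_]; rewrite (negPf iy).
by move=> j; rewrite dotDr !dotZr; have := Px j; have := Py j; lra.
Qed.

(** The point is found where the segment from [z] to a point violating only row
    [i] leaves the polyhedron. *)
Lemma exists_facet_interior z i : P z -> i \notin tight z ->
  (forall y, P y -> tight z \subset tight y) ->
  (exists2 y, b i < dot (a i) y & forall j, j != i -> dot (a j) y <= b j) ->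
  exists2 x, P x & tight x = (i |: tight z)%SET.
Proof.
move=> Pz iz zmin [y yi yj].
have zi : dot (a i) z < b i by rewrite lt_neqAle Pz andbT; move: iz; rewrite inE.
set s := (b i - dot (a i) z) / (dot (a i) y - dot (a i) z).
have den : 0 < dot (a i) y - dot (a i) z by rewrite subr_gt0; exact: lt_trans yi.
have sE : s * (dot (a i) y - dot (a i) z) = b i - dot (a i) z by rewrite divfK ?gt_eqF.
have s0 : 0 < s by rewrite divr_gt0 // subr_gt0.
have s1 : s < 1 by rewrite ltr_pdivrMr // mul1r ltrD2r.
have dE j : dot (a j) (z + s *: (y - z)) = dot (a j) z + s * (dot (a j) y - dot (a j) z).
  by rewrite dotDr dotZr dotBr.
have Px : P (z + s *: (y - z)).
  move=> j; rewrite dE; have [->|ji] := eqVneq j i; first by rewrite sE addrC subrK.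
  by have := yj j ji; have := Pz j; nra.
exists (z + s *: (y - z)) => //; apply/eqP; rewrite finset.eqEsubset; apply/andP; split.
  apply/fintype.subsetP => j; rewrite !inE; have [//|ji /=] := eqVneq j i.
  by rewrite dE => /eqP h; have := yj j ji; have := Pz j => h1 h2; apply/eqP; nra.
rewrite finset.subUset finset.sub1set zmin // andbT inE dE sE.
by rewrite addrC subrK.
Qed.

(** The facets cut out by distinct rows outside [E] are distinct, since each has
    a point at which no other such row is tight. *)
Lemma facet_rows n d : (exists x, P x) ->
  (forall i, exists2 y, b i < dot (a i) y & forall j, j != i -> dot (a j) y <= b j) ->
  has_dim P d -> ([set F | facet P F] #= `I_n)%card ->
  exists E : {set 'I_k}, [/\ (row_rank a E + d)%N = m,
    (forall x, P x -> E \subset tight x) & (#|~: E| <= n)%N].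
Proof.
move=> [x0 Px0] irr dimP hn; have [z Pz zmin] := exists_relative_interior Px0.
set E := tight z; exists E.
have PE : P = tight_face a b E.
  by apply/seteqP; split=> [x Px|x []] //; split=> //; exact: zmin.
have dE : d = (m - row_rank a E)%N.
  by apply: has_dim_unique dimP _; rewrite {1}PE; exact: (has_dim_tight Pz erefl).
have rE : (row_rank a E <= m)%N by exact: rank_leq_col.
split=> //; first by rewrite dE subnKC.
have hi i : i \notin E -> exists2 x, P x & tight x = (i |: E)%SET.
  by move=> iE; exact: exists_facet_interior.
have facet_i i : i \notin E -> facet P (tight_face a b (i |: E)).
  move=> iE; have [x Px tx] := hi i iE; split; first exact: row_face.
  have iclE : i \notin row_closure a E.
    rewrite inE; apply: contra iE => iE; have ox : orthogonal_to a E (x - z).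
      have Ez : E \subset tight z by exact: fintype.subxx.
      by apply: (tight_sub_orthogonal Ez); rewrite tx; exact: finset.subsetU1.
    have := orthogonal_span ox iE; rewrite dotBr => /eqP; rewrite subr_eq0 => /eqP h.
    have : i \in tight x by rewrite tx finset.setU11.
    by rewrite !inE h.
  have := row_rankU1 iclE => rU; have := rank_leq_col (row_span a (i |: E)).
  rewrite -/(row_rank a _) rU => rlt.
  exists (m - (row_rank a E).+1)%N; split.
    by rewrite -[_.+1]/(1 + _)%N addnC addn1 subnSK // -dE.
  by rewrite -rU; exact: has_dim_tight tx.
have := hn; rewrite card_eq_le => /andP[/pcard_leP[g] _].
have gn i : i \notin E -> (g (tight_face a b (i |: E)) < n)%N.
  by move=> /facet_i hf; have := @funS _ _ _ _ g _ hf.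
case: n => [|n] in hn g gn *.
  rewrite leqn0 cards_eq0; apply/eqP/finset.setP => i.
  by rewrite finset.in_setC finset.in_set0; apply/negbTE/negP => iE; have := gn i iE; rewrite ltn0.
rewrite -[X in (_ <= X)%N]card_ord.
rewrite -(@card_in_imset _ _ (fun i => inord (g (tight_face a b (i |: E))) : 'I_n.+1)).
  exact: max_card.
move=> i j; rewrite !finset.in_setC => iE jE /(congr1 (@nat_of_ord _)).
  rewrite !inordK ?gn // => gij.
have := @inj _ _ _ g _ _ _ _ gij; rewrite !inE => /(_ (facet_i i iE) (facet_i j jE)) fij.
have [x Px tx] := hi i iE.
have : tight_face a b (i |: E) x by split=> //; rewrite tx.
rewrite fij => -[_]; rewrite tx => /fintype.subsetP/(_ j); rewrite setU11 => /(_ isT).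
by rewrite finset.in_setU1 (negPf jE) orbF => /eqP.
Qed.
End Facets.

(** The diameter form of [layers_bound]: a shortest walk with [size s] edges
    passes through [size s + 1] layers. *)
Theorem polyhedron_walk_bound (R : realType) m (P : set 'rV[R]_m) d n j u v
  (H : nat -> nat -> nat) :
  (forall j, (2 ^ j <= H 1 j)%N) ->
  (forall d j, (0 < d)%N -> (H d j <= H d.+1 j)%N) ->
  (forall d j, (0 < d)%N -> (d.+1 < 2 ^ j.+1)%N ->
    (H d j.+1 + 2 * H d.+1 j <= H d.+1 j.+1)%N) ->
  polyhedron P -> has_dim P d -> ([set F | facet P F] #= `I_n)%card ->
  (0 < d)%N -> (n < d + 2 ^ j)%N -> vertex P u -> vertex P v ->
  exists2 s, walk P u v s & (size s < H d j)%N.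
Proof.
move=> H1 Hm Hr /irredundant_rows[k [a [b [-> irr]]]] dimP hn d0 nj Vu Vv.
have [|E [rE tE cE]] := facet_rows _ irr dimP hn; first by exists u; exact: vertex_in Vu.
by apply: (row_walk_bound rE tE) => //; exact: leq_ltn_trans nj.
Qed.

(** * A solution of the recursion *)

Section LayerCount.

(** Up to level [c], each unit of corank up to [2 ^ j - 1] contributes
    [2 ^ 'C(j.+1, 2)], the product of the [2 ^ l] for [l <= j]; from then on the
    recursion is Pascal's rule, up to a power of two.  The [maxn] keeps the value
    at [j = 0] equal to one, and [2 ^ j - 1] instead of [2 ^ j] gives the exact
    value two at [j = 1], which bounds the diameter by one when [n = d + 1]. *)
Definition layer_count (c d j : nat) : nat :=
  if (j <= c)%N then (minn d (maxn 1 (2 ^ j).-1) * 2 ^ 'C(j.+1, 2))%N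
  else (2 ^ (c + 'C(c.+1, 2)) * (2 ^ (j - c) * 'C(d + (j - c), j - c)))%N.

Lemma bin2S j : 'C(j.+1, 2) = (j + 'C(j, 2))%N.
Proof. by rewrite binS bin1 addnC. Qed.

Lemma double_bin2S j : (2 * 'C(j.+1, 2) = j.+1 * j)%N.
Proof. by elim: j => // j IHj; rewrite bin2S mulnDr IHj; lia. Qed.

Lemma layer_count_dim1 c j : (2 ^ j <= layer_count c 1 j)%N.
Proof.
rewrite /layer_count; have [jc|jc] := leqP j c.
  rewrite (_ : minn 1 _ = 1%N) ?mul1n ?leq_exp2l //; last lia.
  by rewrite bin2S leq_addr.
rewrite mulnA -expnD -[leqLHS]muln1 leq_mul ?leq_exp2l ?bin_gt0 //; lia.
Qed.

Lemma layer_count_mono c d j : (layer_count c d j <= layer_count c d.+1 j)%N.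
Proof.
rewrite /layer_count; case: ifP => _.
  by rewrite leq_mul2r; apply/orP; right; lia.
by rewrite !leq_mul2l leq_bin2l ?orbT.
Qed.

Lemma layer_count_rec c d j : (0 < d)%N -> (d.+1 < 2 ^ j.+1)%N ->
  (layer_count c d j.+1 + 2 * layer_count c d.+1 j <= layer_count c d.+1 j.+1)%N.
Proof.
move=> d0 dj; rewrite /layer_count; case: (ltngtP j c) => [jc|jc|<-].
- rewrite (bin2S j.+1) expnD; set B := (2 ^ 'C(j.+1, 2))%N.
  have -> : minn d (maxn 1 (2 ^ j.+1).-1) = d by lia.
  have -> : minn d.+1 (maxn 1 (2 ^ j.+1).-1) = d.+1 by lia.
  have : (minn d.+1 (maxn 1 (2 ^ j).-1) <= 2 ^ j)%N by have := expn_gt0 2 j; lia.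
  move=> h; rewrite [leqRHS]mulSn addnC leq_add2r expnS -mulnA leq_mul2l.
  by rewrite leq_mul2r h orbT.
- rewrite subSn ?(ltnW jc) //; set i := (j - c)%N; set K := (2 ^ _)%N.
  rewrite addSn binS -[X in ('C(_, i.+1) + 'C(X, i))%N]addSnnS expnS 2!mulnDr leq_add2l.
  by rewrite !mulnA (mulnC 2 K).
- rewrite subSnn !addn1 !bin1 expn1 expnD.
  set B := (2 ^ 'C(j.+1, 2))%N.
  have : (minn d.+1 (maxn 1 (2 ^ j).-1) <= 2 ^ j)%N by have := expn_gt0 2 j; lia.
  move=> h; have := leq_mul h (leqnn B); lia.
Qed.

Lemma layer_count_gt0 c d j : (0 < d)%N -> (0 < layer_count c d j)%N.
Proof.
elim: d => // -[|d] IHd _; first by apply: leq_trans (layer_count_dim1 c j); rewrite expn_gt0.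
exact: leq_trans (IHd isT) (layer_count_mono _ _ _).
Qed.

Lemma leq_bin_exp d i : ('C(d + i, i) <= d.+1 ^ i)%N.
Proof.
elim: i => [|i IHi]; first by rewrite bin0.
rewrite -(leq_pmul2l (ltn0Sn i)) addnS -mul_bin_diag expnS mulnA.
by apply: leq_mul => //; nia.
Qed.

End LayerCount.

(** * Estimates of the solution *)

Section Estimates.
Variable R : realType.
Implicit Types (G s x : R).

(** At levels [j <= c] the bound is [2 ^ ((j ^ 2 + 3 j) / 2)], that is at
    most of the order of [sqrt d] per level, far below the rate allowed. *)
Lemma layer_count_low G c d j : (2 <= j <= c)%N -> (2 ^ c <= d)%N -> 0 <= G ->
  256 * d%:R <= G ^+ 2 -> (layer_count c d j)%:R <= G ^+ j.-1.
Proof.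
move=> /andP[j2 jc] cd G0 hG; rewrite /layer_count jc.
have : ((minn d (maxn 1 (2 ^ j).-1) * 2 ^ 'C(j.+1, 2)) ^ 2 <= (256 * d) ^ j.-1)%N.
  apply: (@leq_trans ((2 ^ (j + 'C(j.+1, 2))) ^ 2)).
    rewrite leq_sqr expnD leq_mul2r; apply/orP; right.
    by have := expn_gt0 2 j; lia.
  apply: (@leq_trans ((256 * 2 ^ j) ^ j.-1)); last first.
    rewrite leq_exp2r; last lia.
    by rewrite leq_mul2l (leq_trans _ cd) ?leq_exp2l.
  rewrite -[256%N]/(2 ^ 8)%N -expnD -!expnM leq_exp2l // mulnC mulnDr double_bin2S.
  nia.
rewrite -(ler_nat R) !natrX => h.
rewrite -(@ler_pXn2r _ 2) // ?nnegrE ?exprn_ge0 //.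
apply: le_trans h _; rewrite exprAC natrM.
by apply: lerXn2r; rewrite ?nnegrE ?exprn_ge0 ?mulr_ge0.
Qed.

(** For a fixed [d] any rate independent of [j] will do; squaring makes up for
    the exponent [j.-1]. *)
Lemma layer_count_crude d j : (2 <= j)%N ->
  (layer_count 0 d j)%:R <= (((2 * d.+1) ^ 2)%N%:R : R) ^+ j.-1.
Proof.
move=> j2; rewrite /layer_count leqNgt (ltnW j2) /= subn0 mul1n -natrX ler_nat.
apply: leq_trans (leq_mul (leqnn _) (leq_bin_exp d j)) _.
rewrite -expnMn -expnM leq_pexp2l //; lia.
Qed.

(** One term of the binomial expansion of [(1 - s + s) ^+ (d + i)]. *)
Lemma bin_le_inv s d i : 0 < s -> s < 1 ->
  ('C(d + i, i))%:R <= s^-1 ^+ i * (1 - s)^-1 ^+ d.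
Proof.
move=> s0 s1; have s1' : 0 < 1 - s by rewrite subr_gt0.
rewrite !exprVn -invfM -[leRHS]mul1r ler_pdivlMr ?mulr_gt0 ?exprn_gt0 //.
have one : (1 - s + s) ^+ (d + i) = 1 by rewrite subrK expr1n.
rewrite -[leRHS]one [leRHS]exprDn.
have ltin : (i < (d + i).+1)%N by lia.
rewrite (bigD1 (Ordinal ltin)) //= addnK mulr_natl [(1 - s) ^+ d * _]mulrC.
rewrite lerDl; apply: sumr_ge0 => l _.
by rewrite mulrn_wge0 // mulr_ge0 // exprn_ge0 // ltW.
Qed.

Lemma ln_le_sub1 x : 0 < x -> ln x <= x - 1.
Proof. by move=> x0; rewrite -{1}(subrK 1 x) addrC le_ln1Dx // ltrBrDl subrr. Qed.

Lemma ln2_ge : 2^-1 <= ln 2 :> R.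
Proof.
have := @ln_le_sub1 (2^-1) ltac:(lra); rewrite lnV ?posrE //; lra.
Qed.

Lemma ln2_le : ln 2 <= 1 :> R.
Proof. have := @ln_le_sub1 2 ltac:(lra); lra. Qed.

(** Here [expR x = expR (x / 5) ^+ 5 >= (x / 5) ^+ 5]. *)
Lemma expR_dominates_pow4 (K : R) : exists2 L, 1 <= L & forall x, L <= x -> K * x ^+ 4 <= expR x.
Proof.
exists (Num.max 1 (5 ^+ 5 * K)); first by rewrite le_max lexx.
move=> x; rewrite ge_max => /andP[x1 xK]; have x0 : 0 < x by lra.
have -> : x = 5%:R * (x / 5) by field.
rewrite expRM_natl; apply: (@le_trans _ _ ((x / 5) ^+ 5)); last first.
  apply: lerXn2r; rewrite ?nnegrE ?expR_ge0 ?divr_ge0 ?(ltW x0) //.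
  by apply: le_trans (expR_ge1Dx _); lra.
have -> : 5 * (x / 5) = x by field.
rewrite expr_div_n ler_pdivlMr ?exprn_gt0 // (exprS x 4) mulrAC ler_pM2r ?exprn_gt0 //.
by rewrite mulrC.
Qed.
End Estimates.

(** In this section [lam], [mu], [kap] are ln d, ln ln d and ln 2; [gam] is the
    logarithm of the rate, and [eta] the part of it due to the increase of the
    constant [4 * ln 2]. *)
Section HighLevels.
Variable R : realType.

(** The start-up factor and [(1 - s) ^- d] together cost [lam ^+ 2 / kap] to
    leading order, exactly what the first [c] levels provide. *)
Lemma leading_terms (lam mu kap gam c : R) :
  0 <= lam -> 0 <= mu -> 2^-1 <= kap -> 1 <= c -> c * kap <= lam ->
  lam <= (c + 1) * kap -> lam - 2 * mu <= gam -> 2 * mu <= lam ->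
  (c ^+ 2 + 3 * c) * kap / 2 + lam ^+ 2 / (2 * kap) <=
    (c - 1) * gam + lam * (4 * mu + 7 / 2).
Proof.
move=> lam0 mu0 kap1 c1 ckap lamc gam1 mulam.
have kap0 : 0 < kap by lra.
set r := lam / kap; have lamE : lam = r * kap by rewrite /r divfK ?gt_eqF.
have cr : c <= r by rewrite ler_pdivlMr.
have rc : r <= c + 1 by rewrite ler_pdivrMr.
have r2 : r <= 2 * lam by nra.
have -> : lam ^+ 2 / (2 * kap) = r * lam / 2 by rewrite /r; field; lra.
have h1 : c ^+ 2 * kap <= r * lam by rewrite expr2; nra.
have h2 : (c - 1) * (lam - 2 * mu) <= (c - 1) * gam by rewrite ler_wpM2l //; lra.
have h3 : (r - 2) * (lam - 2 * mu) <= (c - 1) * (lam - 2 * mu).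
  by rewrite ler_wpM2r; lra.
have h4 : r * mu <= 2 * lam * mu by rewrite ler_wpM2r.
lra.
Qed.

(** With many levels above [c], the gain [i * eta] pays for the lower order terms
    of [leading_terms]. *)
Lemma high_levels_many (lam mu kap eta gam c i lnC : R) :
  1 <= lam -> 0 <= mu -> 2^-1 <= kap -> 1 <= c -> c * kap <= lam ->
  lam <= (c + 1) * kap -> lam - 2 * mu <= gam -> 2 * mu <= lam ->
  lam * (4 * mu + 5) <= i * eta ->
  i * kap + lnC <= i * (gam - eta) + lam ^+ 2 / (2 * kap) + 1 ->
  (c ^+ 2 + 3 * c) * kap / 2 + i * kap + lnC <= (c - 1 + i) * gam.
Proof.
move=> lam1 mu0 kap1 c1 ckap lamc gam1 mulam hi hC.
have lam0 : 0 <= lam by lra.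
have := leading_terms lam0 mu0 kap1 c1 ckap lamc gam1 mulam; lra.
Qed.

(** With few levels above [c], the crude bound on the binomial costs [o (lam ^+ 2)]
    more than [i] levels provide, and this fits into the half of
    [lam ^+ 2 / kap] that [(1 - s) ^- d] takes in [leading_terms]. *)
Lemma high_levels_few (lam mu kap eta gam c i lnC : R) :
  1 <= lam -> 0 <= mu -> 2^-1 <= kap -> kap <= 1 -> 0 < eta ->
  1 <= c -> c * kap <= lam -> lam <= (c + 1) * kap ->
  lam - 2 * mu <= gam -> 2 * mu <= lam -> 0 <= i ->
  (20 / eta + 8) * (mu + 1) ^+ 2 <= lam ->
  i * eta <= lam * (4 * mu + 5) ->
  lnC <= i * (lam + kap) ->
  (c ^+ 2 + 3 * c) * kap / 2 + i * kap + lnC <= (c - 1 + i) * gam.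
Proof.
move=> lam1 mu0 kap1 kap2 eta0 c1 ckap lamc gam1 mulam i0 hlam hi hC.
have lam0 : 0 <= lam by lra.
have := leading_terms lam0 mu0 kap1 c1 ckap lamc gam1 mulam.
have ieta : i <= lam * (5 * (mu + 1)) / eta.
  by rewrite ler_pdivlMr //; apply: le_trans hi _; rewrite ler_wpM2l //; lra.
have h1 : i * (2 * (mu + 1)) <= lam * (5 * (mu + 1)) / eta * (2 * (mu + 1)).
  by rewrite ler_wpM2r //; lra.
have h2 : lam / 2 * ((20 / eta + 8) * (mu + 1) ^+ 2) <= lam / 2 * lam.
  by rewrite ler_wpM2l //; lra.
have h3 : lam / 2 * lam <= lam ^+ 2 / (2 * kap).
  rewrite mulrAC -expr2 ler_pM2l ?exprn_gt0 //; last lra.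
  by rewrite lef_pV2 ?posrE; lra.
have h4 : i * (lam - 2 * mu) <= i * gam by rewrite ler_wpM2l.
have h5 : i * kap <= i by rewrite ler_piMr.
have h6 : 0 <= lam * mu by rewrite mulr_ge0.
have h7 : 0 <= lam * mu ^+ 2 by rewrite mulr_ge0 ?sqr_ge0.
have -> : (c - 1 + i) * gam = (c - 1) * gam + i * gam by ring.
set e := eta^-1 in h1 h2; lra.
Qed.

(** Whether [i * eta] exceeds the lower order terms, which are of the order of
    [lam * mu], decides which bound on the binomial is used. *)
Lemma layer_count_high (del : R) c d j :
  let lam := ln d%:R in let mu := ln lam in let eta := ln (1 + del) in
  0 < del -> (c < j)%N -> (2 ^ c <= d < 2 ^ c.+1)%N -> 1 <= lam ->
  256 * lam ^+ 4 <= d%:R -> (20 / eta + 8) * (mu + 1) ^+ 2 <= lam ->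
  (layer_count c d j)%:R <= ((1 + del) * (4 * ln 2) * (d%:R / lam ^+ 2)) ^+ j.-1.
Proof.
move=> lam mu eta del0 cj /andP[cd dc] lam1 d256 lammu.
set kap : R := ln 2; set G := (X in _ <= X ^+ _).
have kap1 : 2^-1 <= kap := ln2_ge R; have kap2 : kap <= 1 := ln2_le R.
have eta0 : 0 < eta by apply: ln_gt0; rewrite ltrDl.
have mu0 : 0 <= mu by apply: ln_ge0.
have lam0 : 0 < lam by lra.
have d0 : 0 < d%:R :> R.
  by apply: lt_le_trans d256; rewrite mulr_gt0 // exprn_gt0.
have base0 : 0 < d%:R / lam ^+ 2 by rewrite divr_gt0 ?exprn_gt0.
have kbase0 : 0 < 4 * kap * (d%:R / lam ^+ 2) by rewrite mulr_gt0 //; lra.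
have G0 : 0 < G by rewrite !mulr_gt0 ?invr_gt0 ?exprn_gt0 //; lra.
have lnG : ln G = eta + ln (4 * kap * (d%:R / lam ^+ 2)).
  by rewrite /G -(mulrA (1 + del)) lnM ?posrE // ?addr_gt0.
have lnG' : lam - 2 * mu <= ln (4 * kap * (d%:R / lam ^+ 2)).
  have -> : lam - 2 * mu = ln (d%:R / lam ^+ 2).
    by rewrite ln_div ?posrE ?exprn_gt0 // lnXn // mulr_natl.
  by rewrite ler_ln ?posrE // ler_peMl ?(ltW base0) //; lra.
have c1 : (1 <= c)%N.
  rewrite lt0n; apply/eqP => c0; move: dc; rewrite c0 -(ltr_nat R) => dc.
  have : 1 <= lam ^+ 4 by rewrite exprn_ege1.
  lra.
have ckap : c%:R * kap <= lam.
  rewrite /lam /kap mulr_natl -lnXn // ler_ln ?posrE ?exprn_gt0 //.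
  by rewrite -natrX ler_nat.
have lamc : lam <= (c%:R + 1) * kap.
  rewrite /lam /kap natr1 mulr_natl -lnXn // ler_ln ?posrE ?exprn_gt0 //.
  by rewrite -natrX ler_nat ltnW.
set i := (j - c)%N.
have X0 : 0 < (layer_count c d j)%:R :> R.
  by rewrite ltr0n /layer_count (leqNgt j c) cj /= !muln_gt0 !expn_gt0 bin_gt0 leq_addl.
suff : ln (layer_count c d j)%:R <= ln (G ^+ j.-1).
  by rewrite ler_ln ?posrE ?exprn_gt0.
rewrite lnXn // -[_ *+ j.-1]mulr_natl.
have -> : (j.-1)%:R = c%:R - 1 + i%:R :> R.
  rewrite -(natrB R c1) -natrD; congr _%:R.
  by rewrite /i -[j in LHS](subnKC (ltnW cj)) -subn1 -addnBAC.
have -> : ln (layer_count c d j)%:R =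
   (c%:R ^+ 2 + 3 * c%:R) * kap / 2 + i%:R * kap + ln 'C(d + i, i)%:R :> R.
  rewrite /layer_count (leqNgt j c) cj /= -/i !natrM !natrX.
  have B0 : 0 < 'C(d + i, i)%:R :> R by rewrite ltr0n bin_gt0 leq_addl.
  rewrite lnM ?posrE ?mulr_gt0 ?exprn_gt0 // lnM ?posrE ?exprn_gt0 // addrA !lnXn //.
  rewrite -/kap -[kap *+ i]mulr_natl -[kap *+ _]mulr_natl natrD; congr (_ + _ + _).
  have := congr1 (fun n => n%:R : R) (double_bin2S c).
  rewrite !natrM -natr1 => h; have -> : 'C(c.+1, 2)%:R = (c%:R + 1) * c%:R / 2 :> R by lra.
  by field.
have mulam : 2 * mu <= lam.
  have : 8 * (mu + 1) ^+ 2 <= lam.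
    apply: le_trans lammu; rewrite ler_wpM2r ?sqr_ge0 //.
    by rewrite lerDr divr_ge0 // ltW.
  by rewrite expr2; nra.
have [hi|hi] := leP (i%:R * eta) (lam * (4 * mu + 5)).
  apply: (high_levels_few (lam := lam) (mu := mu) (eta := eta)) => //.
  - by rewrite ler1n.
  - lra.
  apply: (@le_trans _ _ (ln ((d.+1)%:R ^+ i))).
    by rewrite ler_ln ?posrE ?exprn_gt0 ?ltr0n ?bin_gt0 ?leq_addl // -natrX ler_nat leq_bin_exp.
  rewrite lnXn // -[_ *+ i]mulr_natl ler_wpM2l //.
  rewrite /lam /kap -lnM ?posrE // ler_ln ?posrE ?mulr_gt0 // -natrM ler_nat.
  by rewrite -addn1 mulnC mul2n -addnn leq_add2l -(ltr_nat R).
apply: (high_levels_many (lam := lam) (mu := mu) (eta := eta)) => //.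
- by rewrite ler1n.
- lra.
- exact: ltW.
(* This [s] gives [2 / s = 4 * kap * d / lam ^+ 2]. *)
set s := lam ^+ 2 / (2 * kap * d%:R).
have lam2 : lam ^+ 2 <= lam ^+ 4 by rewrite ler_weXn2l.
have s0 : 0 < s by rewrite divr_gt0 ?mulr_gt0 ?exprn_gt0 //; lra.
have sd : s * (2 * kap * d%:R) = lam ^+ 2.
  by rewrite divfK // gt_eqF // !mulr_gt0 //; lra.
have s2 : s <= 2^-1.
  have : s * d%:R <= s * (2 * kap * d%:R).
    by rewrite ler_pM2l // ler_peMl ?(ltW d0) //; lra.
  rewrite sd => h; rewrite -(ler_pM2r d0); lra.
have s1 : s < 1 by lra.
have lnC : ln 'C(d + i, i)%:R <= - (i%:R * ln s) + d%:R * (s + 2 * s ^+ 2).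
  have hb := @bin_le_inv R s d i s0 s1.
  have s1' : 0 < 1 - s by lra.
  apply: (@le_trans _ _ (ln (s^-1 ^+ i * (1 - s)^-1 ^+ d))).
    by rewrite ler_ln ?posrE ?mulr_gt0 ?exprn_gt0 ?invr_gt0 // ltr0n bin_gt0 leq_addl.
  rewrite lnM ?posrE ?exprn_gt0 ?invr_gt0 // !lnXn ?invr_gt0 //.
  rewrite lnV ?posrE // -[_ *+ i]mulr_natl -[_ *+ d]mulr_natl mulrN lerD2l ler_wpM2l //.
  apply: (le_trans (ln_le_sub1 _)); first by rewrite invr_gt0.
  rewrite lerBlDr -[leLHS]mul1r ler_pdivrMr //.
  have : 0 <= s ^+ 2 * (1 - 2 * s) by rewrite mulr_ge0 ?sqr_ge0 //; lra.
  lra.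
have lns : ln s + ln (4 * kap * (d%:R / lam ^+ 2)) = kap.
  have cancel (l k x : R) : l != 0 -> k != 0 -> x != 0 ->
      l ^+ 2 / (2 * k * x) * (4 * k * (x / l ^+ 2)) = 2.
    by move=> l0 k0 x0; field; rewrite l0 k0 x0.
  by rewrite -lnM ?posrE // cancel ?gt_eqF //; lra.
have ds : d%:R * (s + 2 * s ^+ 2) <= lam ^+ 2 / (2 * kap) + 1.
  have -> : d%:R * (s + 2 * s ^+ 2) = lam ^+ 2 / (2 * kap) + 2 * (s * d%:R) * s.
    rewrite -sd; field; lra.
  rewrite lerD2l.
  have sd1 : s * d%:R <= lam ^+ 2 by nra.
  have : (s * d%:R) ^+ 2 <= lam ^+ 4.
    have -> : lam ^+ 4 = (lam ^+ 2) ^+ 2 by rewrite -exprM.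
    by apply: lerXn2r; rewrite ?nnegrE ?sqr_ge0 // mulr_ge0 // ltW.
  move=> h; rewrite -(ler_pM2r d0); rewrite expr2 in h; lra.
rewrite lnG; nra.
Qed.
End HighLevels.

(** * Choice of the rates and conclusion *)

Section Assembly.
Variable R : realType.

Definition rate_unit (d : nat) : R := d%:R / ln d%:R ^+ 2.

(** The exponent [j.-1] is the one that [x >= 2 ^ j.-1] provides in
    [x `^ log2 G], when [x < 2 ^ j]. *)
Definition admissible (d : nat) (e : R) : Prop := 0 <= e /\
  forall j, (2 <= j)%N ->
    exists c, (layer_count c d j)%:R <= ((4 * ln 2 + e) * rate_unit d) ^+ j.-1.

Lemma base_gt0 d : (1 < d)%N -> 0 < rate_unit d.
Proof.
by move=> d1; rewrite divr_gt0 ?exprn_gt0 ?ln_gt0 ?ltr1n ?ltr0n // ltnW.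
Qed.

Lemma four_ln2_ge2 : 2 <= 4 * ln 2 :> R.
Proof. have := ln2_ge R; lra. Qed.

Lemma admissible_up d e e' : (1 < d)%N -> e <= e' -> admissible d e -> admissible d e'.
Proof.
move=> d1 ee' [e0 he]; split=> [|j /he[c hc]]; first exact: le_trans ee'.
have b0 := base_gt0 d1; have := four_ln2_ge2 => k2.
exists c; apply: le_trans hc _; apply: lerXn2r; rewrite ?nnegrE.
- by rewrite mulr_ge0 ?(ltW b0) //; lra.
- by rewrite mulr_ge0 ?(ltW b0) //; lra.
- by rewrite ler_wpM2r ?(ltW b0) // lerD2l.
Qed.

Lemma admissible_exists d : (1 < d)%N -> exists e, admissible d e.
Proof.
move=> d1; have b0 := base_gt0 d1; have := four_ln2_ge2 => k2.
set g : R := ((2 * d.+1) ^ 2)%N%:R; have g0 : 0 <= g by rewrite ler0n.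
have gb0 : 0 <= g / rate_unit d by rewrite divr_ge0 // ltW.
exists (g / rate_unit d); split=> //.
move=> j j2; exists 0%N; apply: le_trans (layer_count_crude R d j2) _.
apply: lerXn2r; rewrite ?nnegrE //.
  by apply: mulr_ge0; [lra|exact: ltW].
rewrite mulrDl divfK ?gt_eqF // -/g lerDr mulr_ge0 ?(ltW b0) //; lra.
Qed.

Lemma admissible_eventually (eps : R) : 0 < eps ->
  exists D, forall d, (D <= d)%N -> admissible d eps.
Proof.
move=> eps0; have k2 := four_ln2_ge2; set del := eps / (4 * ln 2).
have del0 : 0 < del by rewrite divr_gt0 //; lra.
have delE : (1 + del) * (4 * ln 2) = 4 * ln 2 + eps.
  by rewrite mulrDl mul1r divfK // gt_eqF //; lra.
set eta := ln (1 + del).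
have eta0 : 0 < eta by apply: ln_gt0; rewrite ltrDl.
have [L1 L11 hL1] := expR_dominates_pow4 (256 : R).
have [L2 L21 hL2] := expR_dominates_pow4 ((20 / eta + 8) * 4).
set L := Num.max L1 (expR L2).
exists (Num.bound (expR L)) => d Dd.
have hd : expR L <= d%:R.
  apply: (@le_trans _ _ (Num.bound (expR L))%:R); last by rewrite ler_nat.
  by apply/ltW/archi_boundP/ltW/expR_gt0.
have d0 : 0 < d%:R :> R := lt_le_trans (expR_gt0 L) hd.
pose lam : R := ln d%:R; have lamL : L <= lam by rewrite -[L]expRK ler_ln ?posrE ?expR_gt0.
have : L1 <= lam /\ expR L2 <= lam by move: lamL; rewrite /L ge_max => /andP.
move=> [lamL1 lamL2]; have lam1 : 1 <= lam by exact: le_trans lamL1.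
have lam0 : 0 < lam by lra.
pose mu := ln lam; have muL : L2 <= mu by rewrite -[L2]expRK ler_ln ?posrE ?expR_gt0.
have d256 : 256 * lam ^+ 4 <= d%:R by rewrite -[leRHS]lnK ?posrE // hL1.
have mu1 : 1 <= mu by exact: le_trans muL.
have lammu : (20 / eta + 8) * (mu + 1) ^+ 2 <= lam.
  have := hL2 _ muL; rewrite lnK ?posrE //; apply: le_trans.
  rewrite -mulrA ler_wpM2l //.
    by rewrite addr_ge0 // divr_ge0 // ltW.
  have -> : 4 * mu ^+ 4 = (2 * mu ^+ 2) ^+ 2 by ring.
  have mu2 : mu + 1 <= 2 * mu ^+ 2 by rewrite expr2; nra.
  by apply: lerXn2r => //; rewrite nnegrE; lra.
split; first exact: ltW.
move=> j j2; exists (trunc_log 2 d).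
have d0' : (0 < d)%N by rewrite -(ltr_nat R).
have cd := trunc_log_bounds (ltnSn 1) d0'.
have [jc|cj] := leqP j (trunc_log 2 d); last first.
  have := layer_count_high del0 cj cd lam1 d256 lammu.
  by rewrite delE.
apply: layer_count_low; rewrite ?j2 //; first by case/andP: cd.
  by rewrite mulr_ge0 ?divr_ge0 ?sqr_ge0 //; lra.
have b0 : 0 <= rate_unit d by rewrite divr_ge0 ?sqr_ge0.
have : (2 * rate_unit d) ^+ 2 <= ((4 * ln 2 + eps) * rate_unit d) ^+ 2.
  apply: lerXn2r; rewrite ?nnegrE; [by apply: mulr_ge0| |].
    by apply: mulr_ge0 => //; lra.
  by rewrite ler_wpM2r //; lra.
apply: le_trans.
have -> : (2 * rate_unit d) ^+ 2 = 4 * d%:R ^+ 2 / lam ^+ 4.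
  by rewrite /rate_unit -/lam; field; rewrite gt_eqF.
rewrite ler_pdivlMr ?exprn_gt0 // (expr2 d%:R); nra.
Qed.

(** The infimum of the admissible constants tends to zero; adding [d.+1%:R^-1]
    makes it admissible without having to show that it is attained. *)
Lemma admissible_error : exists e : nat -> R, e @ \oo --> (0 : R) /\
  forall d, (1 < d)%N -> admissible d (e d).
Proof.
pose A d : set R := [set e | admissible d e].
have lbA d : lbound (A d) 0 by move=> x [].
have infA d : (1 < d)%N -> has_inf (A d).
  move=> d1; split; last by exists 0.
  by have [e he] := admissible_exists d1; exists e.
exists (fun d => inf (A d) + d.+1%:R^-1); split; last first.
  move=> d d1; have [|x Ax xlt] := @inf_adherent _ (A d) (d.+1%:R^-1) _ (infA d d1).
    by rewrite invr_gt0.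
  exact: admissible_up d1 (ltW xlt) Ax.
apply/cvgrPdist_lt => eps eps0.
have eps2 : 0 < eps / 2 by lra.
have [D hD] := admissible_eventually eps2.
near=> d; rewrite /= sub0r normrN.
have d1 : (1 < d)%N by near: d; exists 2%N.
have inf0 : 0 <= inf (A d) by apply: lb_le_inf; [case: (infA d d1)|exact: lbA].
have infe : inf (A d) <= eps / 2.
  apply: ge_inf; first by case: (infA d d1).
  by apply: hD; near: d; exists D.
have : d.+1%:R^-1 < eps / 2.
  near: d.
  by apply: near_infty_natSinv_lt (PosNum eps2).
have : 0 <= d.+1%:R^-1 :> R by rewrite invr_ge0.
move=> h1 h2; by rewrite ger0_norm ?addr_ge0 // [ltRHS]splitr ler_ltD.
Unshelve. all: by end_near.
Qed.

Lemma Delta_u_le d n (B : R) :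
  (forall m (P : set 'rV[R]_m) u v, polyhedron P -> has_dim P d ->
     ([set F | facet P F] #= `I_n)%card -> vertex P u -> vertex P v ->
     exists2 s, walk P u v s & (size s)%:R <= B) ->
  (Delta_u R d n <= B%:E)%E.
Proof.
move=> h; apply: ge_ereal_sup => _ [m [P [polyP _ dimP nP ->]]].
apply: ge_ereal_sup => _ [[u v] /= [Vu Vv] <-].
have [s us sB] := h m P u v polyP dimP nP Vu Vv.
apply: (@le_trans _ _ ((size s)%:R)%:E); last by rewrite lee_fin.
by apply: ereal_inf_lbound; exists s.
Qed.

Lemma admissible_Delta_u d n e : (1 < d)%N -> (d <= n)%N -> admissible d e ->
  (Delta_u R d n <=
    ((n - d)%N%:R `^ log2 ((4 * ln 2 + e) * rate_unit d))%:E)%E.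
Proof.
move=> d1 dn [e0 he]; apply: Delta_u_le => m P u v polyP dimP nP Vu Vv.
have d0 : (0 < d)%N by exact: ltnW.
set G := _ * rate_unit d; set x := (n - d)%N.
have walks c j : (x < 2 ^ j)%N ->
    exists2 s, walk P u v s & (size s < layer_count c d j)%N.
  move=> xj; apply: (polyhedron_walk_bound (layer_count_dim1 c) _ _ polyP dimP nP) => //.
  - by move=> *; exact: layer_count_mono.
  - exact: layer_count_rec.
  - by rewrite -(subnKC dn) ltn_add2l.
(* For [x <= 1] the claim leaves no room, and the exact values of [layer_count]
   are needed. *)
have [x0|x1] := leqP x 0.
  have [|s us hs] := walks 1%N 0%N; first by rewrite expn0 ltnS.
  exists s => //; apply: le_trans (powR_ge0 _ _).
  by move: hs; rewrite /layer_count /= (minn_idPr _) // bin2 /= muln1 ltnS leqn0 => /eqP ->.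
have [x2|x2] := leqP x 1.
  have [|s us hs] := walks 1%N 1%N; first by rewrite expn1.
  exists s => //; have -> : x = 1%N by apply/eqP; rewrite eqn_leq x2.
  rewrite powR1 lern1.
  by move: hs; rewrite /layer_count /= (minn_idPr _).
set j := trunc_log 2 x.
have /andP[jx xj] := trunc_log_bounds (ltnSn 1) x1.
have j1 : (0 < j)%N by rewrite trunc_log_gt0.
have [c hc] := he j.+1 j1.
have [s us hs] := walks c j.+1 xj; exists s => //.
apply: (@le_trans _ _ (G ^+ j)).
  by apply: le_trans hc; rewrite ler_nat ltnW.
(* The rate is at least one because it bounds a positive integer. *)
have [c' hc'] := he 2%N isT.
have G1 : 1 <= G.
  apply: le_trans hc'; rewrite ler1n.
  exact: layer_count_gt0.
rewrite -[G ^+ j]powR_mulrn ?(le_trans ler01) //.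
have ln2_gt0 : 0 < ln 2 :> R by rewrite ln_gt0 // ltr1n.
have log0 : 0 <= log2 G by apply: divr_ge0; [exact: ln_ge0|exact: ltW].
have GE : G = 2 `^ log2 G.
  by rewrite /powR pnatr_eq0 /= divfK ?gt_eqF // lnK // posrE (lt_le_trans ltr01).
rewrite {1}GE -powRrM mulrC powRrM powR_mulrn // -natrX.
by apply: ge0_ler_powR; rewrite ?nnegrE ?ler0n ?ler_nat.
Qed.
End Assembly.

Theorem theorem1 (R : realType) :
  exists G : nat -> R,
    (forall d : nat, (4 <= d)%N -> 0 < G d) /\
    (forall d n : nat, (4 <= d)%N -> (d <= n)%N ->
       (Delta_u R d n <= ((n - d)%N%:R `^ log2 (G d))%:E)%E) /\
    (exists e : nat -> R,
       e @ \oo --> (0 : R) /\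
       forall d : nat, (4 <= d)%N ->
         G d = (4 * ln 2 + e d) * (d%:R / ln d%:R ^+ 2)).
Proof.
have [e [e0 adm]] := admissible_error R.
exists (fun d => (4 * ln 2 + e d) * rate_unit R d); split; [|split].
- move=> d d4; have d1 : (1 < d)%N by exact: leq_trans d4.
  have [ed _] := adm d d1; have := four_ln2_ge2 R => k2.
  by rewrite mulr_gt0 ?base_gt0 //; lra.
- move=> d n d4 dn; have d1 : (1 < d)%N by exact: leq_trans d4.
  exact: admissible_Delta_u (adm d d1).
- by exists e.
Qed.
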